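(* Let $U \subset \mathbb{R}^3$ be an open set. The space of all Beltrami fields on $U$ (that is, of all vector fields $\mathbf{u}$ on $U$ such that $\operatorname{curl} \mathbf{u} = f\,\mathbf{u}$ and $\operatorname{div} \mathbf{u} = 0$ for some function $f : U \to \mathbb{R}$, where $f$ is not prescribed and is allowed to vary with $\mathbf{u}$) is locally parametrized by 3 functions of 2 variables.
   Context: Definition. A Beltrami field on an open set $U \subset \mathbb{R}^3$ is a vector field $\mathbf{u}$ on $U$ satisfying $\operatorname{curl}\mathbf{u} = f\mathbf{u}$, $\operatorname{div}\mathbf{u} = 0$ for some smooth function $f:U\to\mathbb{R}$, called the proportionality factor. Standing conventions. Only locally defined, real analytic functions $f$ and Beltrami fields $\mathbf{u}$ are considered. All statements are local: $U$ may be replaced by a smaller open set whenever necessary. An assumption ''$X$ is nonzero'' is to be read as ''$X$ is not identically zero, and we restrict to the open set where $X$ is nonzero''. Meaning of ''locally parametrized by $k$ functions of $n$ variables''. This is the usual function count of the Cauchy–Kowalevski and Cartan–Kähler theorems: near a generic point, real analytic local solutions of the PDE system under consideration are in correspondence with freely chosen initial data consisting of $k$ arbitrary real analytic functions of $n$ variables, up to arbitrary functions of fewer than $n$ variables and constants, which are not counted. Equivalently, the associated involutive exterior differential system (after prolongation if needed) has last nonzero Cartan character $s_n = k$. *)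

(* Defs.v *)
From HB Require Import structures.
From mathcomp Require Import all_boot all_order all_algebra.
From mathcomp Require Import all_classical all_reals all_analysis.
Set Implicit Arguments.
Unset Strict Implicit.
Unset Printing Implicit Defensive.
Import Order.TTheory GRing.Theory Num.Theory.
Import numFieldNormedType.Exports.
Local Open Scope classical_set_scope.
Local Open Scope ring_scope.

Definition monomial (R : realType) (d : nat) (a : {ffun 'I_d -> nat})
    (z : 'rV[R]_d) : R :=
  \prod_(i < d) z ord0 i ^+ a i.

(* Absolute convergence is required separately, so that the value of the sum
   does not depend on the (here cubical) order of summation. *)
Definition analytic_at (R : realType) (d : nat) (g : 'rV[R]_d -> R)
    (p : 'rV[R]_d) : Prop :=
  exists c : {ffun 'I_d -> nat} -> R, \forall x \near p,
    summable setT (fun a => (c a * monomial a (x - p))%:E) /\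
    (fun n : nat => \sum_(b : {ffun 'I_d -> 'I_n})
        let a := [ffun i => nat_of_ord (b i)] in c a * monomial a (x - p))
      @ \oo --> g x.

Definition analytic_on (R : realType) (d : nat) (V : set 'rV[R]_d)
    (g : 'rV[R]_d -> R) : Prop :=
  forall p, V p -> analytic_at g p.

Definition partial (R : realType) (d N : nat) (i : 'I_d)
    (u : 'rV[R]_d -> 'rV[R]_N) (j : 'I_N) (x : 'rV[R]_d) : R :=
  'D_(delta_mx ord0 i) (fun y => u y ord0 j) x.

(* Index arithmetic is modulo 3. *)
Definition curl (R : realType) (u : 'rV[R]_3 -> 'rV[R]_3) (x : 'rV[R]_3) :
    'rV[R]_3 :=
  \row_(i < 3) (partial (i + 1) u (i + 2) x - partial (i + 2) u (i + 1) x).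

Definition divergence (R : realType) (u : 'rV[R]_3 -> 'rV[R]_3)
    (x : 'rV[R]_3) : R :=
  \sum_(i < 3) partial i u i x.

(* Fields are total functions; only their values on V matter, V being open. *)
Definition beltrami_field (R : realType) (V : set 'rV[R]_3)
    (u : 'rV[R]_3 -> 'rV[R]_3) : Prop :=
  (forall i, analytic_on V (fun x => u x ord0 i)) /\
  exists f : 'rV[R]_3 -> R, analytic_on V f /\
    forall x, V x -> curl u x = f x *: u x /\ divergence u x = 0.

Section function_count.
Variables (R : realType) (d N : nat).

(* A solution class is a set of fields on each open subset of R^d. *)
Implicit Types (Sol : set 'rV[R]_d -> ('rV[R]_d -> 'rV[R]_N) -> Prop)
  (p : 'rV[R]_d) (A : 'M[R]_d) (u v : 'rV[R]_d -> 'rV[R]_N).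

Definition solution_near Sol (U : set 'rV[R]_d) p u : Prop :=
  exists V : set 'rV[R]_d, [/\ open V, V p, V `<=` U & Sol V u].

(* One Cauchy datum: the iterated derivative, in the directions given by the
   frame vectors listed in [ders], of the linear combination [covec] of the
   unknowns, restricted to the plane of dimension [nvars] spanned at p by the
   first frame vectors. *)
Record datum := Datum {
  nvars : nat;
  covec : 'cV[R]_N;
  ders : seq 'I_d
}.

(* The frame vectors are the rows of A. *)
Definition datum_value p A (s : datum) u (y : 'rV[R]_(nvars s)) : R :=
  foldr (fun i (h : 'rV[R]_d -> R) => 'D_(row i A) h)
    (fun x => (u x *m covec s) ord0 ord0) (ders s)
    (p + y *m (pid_mx (nvars s) : 'M[R]_(nvars s, d)) *m A).

Arguments datum_value : clear implicits.

(* The data s, restricted to the solution germs at p with value in W at p,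
   form a bijection onto all tuples of analytic germs with value in D at 0. *)
Definition cauchy_bijection Sol (U : set 'rV[R]_d) p (W : set 'rV[R]_N) A
    (J : nat) (s : 'I_J -> datum) (D : set 'rV[R]_J) : Prop :=
  [/\ forall u, solution_near Sol U p u -> W (u p) ->
        (forall j, analytic_at (datum_value p A (s j) u) 0) /\
        D (\row_j datum_value p A (s j) u 0),
      forall phi : forall j, 'rV[R]_(nvars (s j)) -> R,
        (forall j, analytic_at (phi j) 0) -> D (\row_j phi j 0) ->
        exists u, [/\ solution_near Sol U p u, W (u p) &
          forall j, \forall y \near (0 : 'rV[R]_(nvars (s j))),
            datum_value p A (s j) u y = phi j y]
    & forall u v,
        solution_near Sol U p u -> W (u p) ->
        solution_near Sol U p v -> W (v p) ->
        (forall j, \forall y \near (0 : 'rV[R]_(nvars (s j))),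
            datum_value p A (s j) u y = datum_value p A (s j) v y) ->
        \forall x \near p, u x = v x].

(* The solutions over U are locally parametrized by k functions of n
   variables, G being the set of generic values of a field at a point.  Data
   depending on fewer than n variables are allowed and not counted. *)
Definition locally_parametrized Sol (U : set 'rV[R]_d) (G : set 'rV[R]_N)
    (k n : nat) : Prop :=
  [/\ open G, dense G &
    forall p a, U p -> G a ->
    exists (W : set 'rV[R]_N) (A : 'M[R]_d) (J : nat) (s : 'I_J -> datum)
      (D : set 'rV[R]_J),
      [/\ open W /\ W a, A \in unitmx, open D /\ D !=set0,
          (forall j, (nvars (s j) <= n)%N) /\
            #|[pred j | nvars (s j) == n]| = k
        & cauchy_bijection Sol U p W A s D]].

End function_count.

(* Main.v *)
Require Import Defs.
From HB Require Import structures.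
From mathcomp Require Import all_boot all_order all_algebra.
From mathcomp Require Import all_classical all_reals all_analysis.
From mathcomp Require Import perm finmap lra ring zify.
Set Implicit Arguments.
Unset Strict Implicit.
Unset Printing Implicit Defensive.
Import Order.TTheory GRing.Theory Num.Theory.
Import numFieldNormedType.Exports.
Local Open Scope classical_set_scope.
Local Open Scope ring_scope.

(** A Beltrami field with [u k <> 0] is determined by its three components on a
    plane transverse to it.  Let [k] be the index of a nonzero component of the
    prescribed value, and take the plane through the point on which the
    coordinate [k] is constant.  The [k]-th component of [curl u = f u] reads
      [f = (D_{k+1} u_{k+2} - D_{k+2} u_{k+1}) / u_k],
    and once [f] is replaced by this value the two other components and
    [div u = 0] become
      [D_k u_{k+1} = D_{k+1} u_k + f u_{k+2}],
      [D_k u_{k+2} = D_{k+2} u_k - f u_{k+1}],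
      [D_k u_k = - D_{k+1} u_{k+1} - D_{k+2} u_{k+2}].
    This is a determined first-order system, solved for the derivatives in the
    direction [k], so that the Cauchy-Kovalevskaya theorem gives a bijection
    between the solutions and the values of [u] on the plane, which are three
    analytic functions of two variables subject only to [u_k <> 0].  No
    compatibility condition is left over.

    The system becomes polynomial when the reciprocal [w] of [u_k] is added as an
    unknown, with [D_k w = w ^ 2 (D_{k+1} u_{k+1} + D_{k+2} u_{k+2})].  The
    relation [w u_k = 1] then propagates off the plane, since the defect
    [w u_k - 1] satisfies a homogeneous linear evolution equation
    ([beltrami_exists]).

    The Cauchy-Kovalevskaya theorem ([ck_exists], [ck_unique]) is proved for
    systems [D_k U_i = sum of c U_a U_b D_m U_l] with [m <> k].  The coefficients
    of the solution are given by recursion on the exponent of the variable [k]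
    ([trifix]), which yields uniqueness.  For convergence ([ck_sol_bound]), they
    are majorized by those of [C phi(r (sum of x_i, i <> k) + la r x_k)], where
    [phi] has coefficients [1 / (n + 1) ^ 2]: its square is at most 8 times
    [phi], coefficient by coefficient, so that the cubic terms are bounded by a multiple of the derivative of
    [phi], which is absorbed by a large [la].  Products of such majorants are
    computed by [sconv_majs].

    The passage between functions and coefficients relies on absolutely summable
    families ([tsum_exchange]): products ([has_seriesM]), recentring
    ([pser_shift]), termwise differentiation ([has_series_deriv]) and uniqueness
    of coefficients ([has_series0]). *)

(** * Unordered sums of absolutely summable families *)

Section UnorderedSums.
Variable R : realType.
Implicit Types T K : choiceType.

(** The sum of the absolute values of a family, as an extended real; a family
    [f] is absolutely summable when [(asum f < +oo)%E]. *)
Definition asum T (f : T -> R) : \bar R := \esum_(t in setT) `|f t|%:E.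

(** The unordered sum of a family: sum of the positive parts minus sum of the
    negative parts.  It is meaningful for absolutely summable families only. *)
Definition tsum T (f : T -> R) : R :=
  fine (\esum_(t in setT) (Num.max (f t) 0)%:E) -
  fine (\esum_(t in setT) (Num.max (- f t) 0)%:E).

Lemma asum_ge0 T (f : T -> R) : (0 <= asum f)%E.
Proof. by apply: esum_ge0 => t _; rewrite lee_fin. Qed.

Lemma le_asum T (f g : T -> R) : (forall t, `|f t| <= `|g t|) ->
  (asum f <= asum g)%E.
Proof. by move=> fg; apply: le_esum => t _; rewrite lee_fin. Qed.

Lemma asum_fin T (f : T -> R) : (asum f < +oo)%E -> asum f \is a fin_num.
Proof. by move=> h; rewrite ge0_fin_numE// asum_ge0. Qed.

Lemma asum_ge T (f : T -> R) (s : seq T) : uniq s ->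
  ((\sum_(t <- s) `|f t|)%:E <= asum f)%E.
Proof.
move=> us; apply: esum_ge; exists [set` s]; first by split => //; exact: finite_seq.
by rewrite -fsbig_seq// sumEFin.
Qed.

Lemma asum_le T (f : T -> R) (M : R) :
  (forall s : seq T, uniq s -> \sum_(t <- s) `|f t| <= M) -> (asum f <= M%:E)%E.
Proof.
move=> h; apply: ge_ereal_sup => _ [X [finX _] <-].
by rewrite fsbig_finite//= sumEFin lee_fin h.
Qed.

Lemma asum_term T (f : T -> R) (M : R) t : (asum f <= M%:E)%E -> `|f t| <= M.
Proof.
move=> h; have := le_trans (@asum_ge _ f [:: t] isT) h.
by rewrite big_seq1 lee_fin.
Qed.

Lemma asum_fineP T (f : T -> R) : (asum f < +oo)%E ->
  exists2 M : R, 0 <= M & asum f = M%:E.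
Proof.
move=> h; exists (fine (asum f)); first by rewrite fine_ge0// asum_ge0.
by rewrite fineK// asum_fin.
Qed.

Lemma pos_sumP T (f : T -> R) : (forall t, 0 <= f t) ->
  (\esum_(t in setT) (f t)%:E < +oo)%E -> forall e, 0 < e ->
  exists2 s0 : seq T, uniq s0 & forall s, uniq s -> {subset s0 <= s} ->
    `|\sum_(t <- s) f t - fine (\esum_(t in setT) (f t)%:E)| <= e.
Proof.
move=> f0 foo e e0.
have [M M0 EM] : exists2 M : R, 0 <= M & \esum_(t in setT) (f t)%:E = M%:E.
  have := @asum_fineP T f; rewrite /asum.
  rewrite (@eq_esum _ _ _ (fun t => `|f t|%:E) (fun t => (f t)%:E)) => [|t _].
    by apply.
  by rewrite ger0_norm.
rewrite EM /=.
have : ((M - e)%:E < \esum_(t in setT) (f t)%:E)%E.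
  by rewrite EM lte_fin ltrBlDr ltrDl.
move=> /ereal_sup_gt[_ [X [finX _] <-]]; rewrite fsbig_finite//= sumEFin lte_fin => ltX.
exists (fset_set X) => // s us sub.
have up : \sum_(t <- s) f t <= M.
  rewrite -lee_fin -EM; apply: esum_ge; exists [set` s].
    by split => //; exact: finite_seq.
  by rewrite -fsbig_seq// sumEFin.
have lo : \sum_(t <- fset_set X) f t <= \sum_(t <- s) f t.
  rewrite [leRHS](bigID (mem (fset_set X)))/= -[leLHS]addr0 lerD//.
    rewrite -[leRHS]big_filter le_eqVlt; apply/orP; left; apply/eqP.
    apply: perm_big; apply: uniq_perm => //; first exact: filter_uniq.
    by move=> t; rewrite mem_filter; case: (boolP (_ \in _)) => //= /sub ->.
  by apply: sumr_ge0 => t _.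
by rewrite ler_norml; apply/andP; split; lra.
Qed.

Lemma asum_pos T (f : T -> R) : (asum f < +oo)%E ->
  (\esum_(t in setT) (Num.max (f t) 0)%:E < +oo)%E.
Proof.
apply: le_lt_trans; apply: le_esum => t _; rewrite lee_fin ge_max normr_ge0.
by rewrite ler_norm.
Qed.

Lemma asumN T (f : T -> R) : asum (fun t => - f t) = asum f.
Proof. by apply: eq_esum => t _; rewrite normrN. Qed.

Lemma asum_neg T (f : T -> R) : (asum f < +oo)%E ->
  (\esum_(t in setT) (Num.max (- f t) 0)%:E < +oo)%E.
Proof. by rewrite -asumN => /asum_pos. Qed.

Lemma maxrB (x : R) : x = Num.max x 0 - Num.max (- x) 0.
Proof. by case: (leP x 0) => h1; case: (leP (-x) 0) => h2; lra. Qed.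

(** [tsum f] is the limit of the finite partial sums along the directed set of
    finite sets of indices. *)
Lemma tsumP T (f : T -> R) : (asum f < +oo)%E -> forall e, 0 < e ->
  exists2 s0 : seq T, uniq s0 & forall s, uniq s -> {subset s0 <= s} ->
    `|\sum_(t <- s) f t - tsum f| <= e.
Proof.
move=> foo e e0; have e20 : 0 < e / 2 by lra.
have [s1 u1 h1] := @pos_sumP T (fun t => Num.max (f t) 0)
  (fun t => ltac:(by rewrite le_max lexx orbT)) (asum_pos foo) _ e20.
have [s2 u2 h2] := @pos_sumP T (fun t => Num.max (- f t) 0)
  (fun t => ltac:(by rewrite le_max lexx orbT)) (asum_neg foo) _ e20.
exists (undup (s1 ++ s2)) => [|s us sub]; first exact: undup_uniq.
have {}h1 := h1 s us (fun t ts => sub t ltac:(by rewrite mem_undup mem_cat ts)).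
have {}h2 := h2 s us (fun t ts => sub t ltac:(by rewrite mem_undup mem_cat ts orbT)).
rewrite (eq_bigr (fun t => Num.max (f t) 0 - Num.max (- f t) 0)); last first.
  by move=> t _; exact: maxrB.
rewrite sumrB /tsum.
move: h1 h2; rewrite !ler_norml => /andP[a1 a2] /andP[b1 b2].
by apply/andP; split; lra.
Qed.

Lemma tsum_uniq T (f : T -> R) (l : R) : (asum f < +oo)%E ->
  (forall e, 0 < e -> exists2 s0 : seq T, uniq s0 &
     forall s, uniq s -> {subset s0 <= s} -> `|\sum_(t <- s) f t - l| <= e) ->
  tsum f = l.
Proof.
move=> foo h; apply/eqP; rewrite -subr_eq0 -normr_le0 leNgt; apply/negP => lt0.
have e0 : 0 < `|tsum f - l| / 3 by rewrite divr_gt0.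
have [s1 u1 h1] := tsumP foo e0; have [s2 u2 h2] := h _ e0.
pose s := undup (s1 ++ s2).
have us : uniq s by exact: undup_uniq.
have {}h1 := h1 s us (fun t ts => ltac:(by rewrite mem_undup mem_cat ts)).
have {}h2 := h2 s us (fun t ts => ltac:(by rewrite mem_undup mem_cat ts orbT)).
have : `|tsum f - l| <= `|\sum_(t <- s) f t - l| + `|\sum_(t <- s) f t - tsum f|.
  by rewrite (distrC _ (tsum f)) [leRHS]addrC; exact: ler_distD.
move: h1 h2 lt0; set x := `|tsum f - l|; lra.
Qed.

Lemma asumD T (f g : T -> R) : (asum f < +oo)%E -> (asum g < +oo)%E ->
  (asum (fun t => f t + g t)%R < +oo)%E.
Proof.
move=> /asum_fineP[M M0 EM] /asum_fineP[N N0 EN].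
apply: (@le_lt_trans _ _ (M + N)%:E); last by rewrite ltry.
apply: asum_le => s us; apply: (@le_trans _ _ (\sum_(t <- s) (`|f t| + `|g t|))).
  by apply: ler_sum => t _; exact: ler_normD.
rewrite big_split lerD//= -lee_fin.
  by rewrite -EM asum_ge.
by rewrite -EN asum_ge.
Qed.

Lemma asumZ T (f : T -> R) (k : R) : (asum f < +oo)%E ->
  (asum (fun t => k * f t)%R <= (`|k| * fine (asum f))%:E)%E.
Proof.
move=> foo; apply: asum_le => s us.
rewrite (eq_bigr (fun t => `|k| * `|f t|)); last by move=> t _; rewrite normrM.
rewrite -mulr_sumr ler_wpM2l// -lee_fin fineK ?asum_fin//; exact: asum_ge.
Qed.

Lemma asumZ_fin T (f : T -> R) (k : R) : (asum f < +oo)%E ->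
  (asum (fun t => k * f t)%R < +oo)%E.
Proof. by move=> /asumZ/le_lt_trans; apply; rewrite ltry. Qed.

Lemma tsumD T (f g : T -> R) : (asum f < +oo)%E -> (asum g < +oo)%E ->
  tsum (fun t => f t + g t) = tsum f + tsum g.
Proof.
move=> foo goo; apply: tsum_uniq; first exact: asumD.
move=> e e0; have e20 : 0 < e / 2 by lra.
have [s1 u1 h1] := tsumP foo e20; have [s2 u2 h2] := tsumP goo e20.
exists (undup (s1 ++ s2)) => [|s us sub]; first exact: undup_uniq.
have {}h1 := h1 s us (fun t ts => sub t ltac:(by rewrite mem_undup mem_cat ts)).
have {}h2 := h2 s us (fun t ts => sub t ltac:(by rewrite mem_undup mem_cat ts orbT)).
rewrite big_split opprD addrACA (le_trans (ler_normD _ _))//= [leRHS](splitr e).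
exact: lerD.
Qed.

Lemma tsumZ T (f : T -> R) (k : R) : (asum f < +oo)%E ->
  tsum (fun t => k * f t) = k * tsum f.
Proof.
move=> foo; apply: tsum_uniq; first exact: asumZ_fin.
move=> e e0; have k0 : 0 < `|k| + 1 by rewrite ltr_pwDr.
have [s1 u1 h1] := tsumP foo (divr_gt0 e0 k0).
exists s1 => // s us sub; rewrite -mulr_sumr -mulrBr normrM.
apply: (@le_trans _ _ (`|k| * (e / (`|k| + 1)))).
  by rewrite ler_wpM2l// h1.
by rewrite mulrCA ler_piMr ?(ltW e0)// ler_pdivrMr// mul1r lerDl.
Qed.

Lemma tsum_norm T (f : T -> R) (M : R) : (asum f <= M%:E)%E -> `|tsum f| <= M.
Proof.
move=> fM; have foo : (asum f < +oo)%E by apply: le_lt_trans fM _; rewrite ltry.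
apply/ler_addgt0Pr => e e0; have [s us /(_ s us)h] := tsumP foo e0.
have {}h := h (fun _ => id).
have := le_trans (asum_ge f us) fM; rewrite lee_fin => {}fM.
have := ler_norm_sum s f predT.
have := ler_distD (\sum_(t <- s) f t) (tsum f) 0.
rewrite !subr0 distrC; lra.
Qed.

Lemma asum_supp T (f : T -> R) (s : seq T) : uniq s ->
  (forall t, t \notin s -> f t = 0) -> (asum f <= (\sum_(t <- s) `|f t|)%:E)%E.
Proof.
move=> us f0; apply: asum_le => s' us'.
rewrite (bigID (mem s))/= [X in _ + X]big1 ?addr0; last first.
  by move=> t /f0 ->; rewrite normr0.
rewrite -big_filter; set s2 := [seq t <- _ | _].
have u2 : uniq s2 by exact: filter_uniq.
rewrite [leRHS](bigID (mem s2))/= -[leLHS]addr0 lerD ?sumr_ge0//.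
rewrite -[leRHS]big_filter le_eqVlt; apply/orP; left; apply/eqP.
apply: perm_big; apply: uniq_perm => //; first exact: filter_uniq.
by move=> t; rewrite !mem_filter; case: (boolP (t \in s)); rewrite //= andbT.
Qed.

Lemma asum_supp_fin T (f : T -> R) (s : seq T) : uniq s ->
  (forall t, t \notin s -> f t = 0) -> (asum f < +oo)%E.
Proof. by move=> us /(asum_supp us)/le_lt_trans; apply; rewrite ltry. Qed.

Lemma tsum_supp T (f : T -> R) (s : seq T) : uniq s ->
  (forall t, t \notin s -> f t = 0) -> tsum f = \sum_(t <- s) f t.
Proof.
move=> us f0; apply: tsum_uniq => [|e e0].
  exact: asum_supp_fin us f0.
exists s => // s' us' sub.
rewrite [X in X - _](bigID (mem s))/= [X in _ + X - _]big1 ?addr0; last first.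
  by move=> t /f0.
rewrite -big_filter (perm_big s) ?subrr ?normr0 ?ltW//.
apply: uniq_perm => //; first exact: filter_uniq.
by move=> t; rewrite mem_filter; case: (boolP (_ \in _)) => //= /sub ->.
Qed.

Lemma eq_tsum T (f g : T -> R) : f =1 g -> tsum f = tsum g.
Proof. by move=> /funext ->. Qed.

Lemma eq_asum T (f g : T -> R) : f =1 g -> asum f = asum g.
Proof. by move=> /funext ->. Qed.

Lemma esum_inj K T (h : K -> T) (f : T -> \bar R) : injective h ->
  (forall t, (forall k, h k <> t) -> f t = 0%E) ->
  \esum_(t in setT) f t = \esum_(k in setT) f (h k).
Proof.
move=> hinj fz.
rewrite -(@esum_image _ _ _ setT h f) => [|a b _ _ /hinj//].
  rewrite [RHS]esum_mkcond; apply: eq_esum => t _; case: ifPn => // nt.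
  apply: fz => k hk; move/negP: nt; apply; apply: mem_set; exists k => //.
Qed.

Lemma asum_inj K T (h : K -> T) (f : T -> R) : injective h ->
  (forall t, (forall k, h k <> t) -> f t = 0) -> asum f = asum (f \o h).
Proof.
move=> hinj fz; apply: esum_inj => // t.
by move=> /fz ->; rewrite normr0.
Qed.

Lemma tsum_inj K T (h : K -> T) (f : T -> R) : injective h ->
  (forall t, (forall k, h k <> t) -> f t = 0) -> tsum f = tsum (f \o h).
Proof.
move=> hinj fz; rewrite /tsum; congr (fine _ - fine _); apply: esum_inj => // t.
- by move=> /fz ->; rewrite maxxx.
- by move=> /fz ->; rewrite oppr0 maxxx.
Qed.

Lemma esum_exchange T K (F : T -> K -> R) : (forall t k, 0 <= F t k) ->
  \esum_(t in setT) \esum_(k in setT) (F t k)%:E =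
  \esum_(k in setT) \esum_(t in setT) (F t k)%:E.
Proof.
move=> F0.
rewrite (@esum_esum R T K setT (fun=> setT) (fun t k => (F t k)%:E)); last first.
  by move=> *; rewrite lee_fin.
rewrite (@esum_esum R K T setT (fun=> setT) (fun k t => (F t k)%:E)); last first.
  by move=> *; rewrite lee_fin.
apply: (@reindex_esum R (K * T)%type (T * K)%type _ _ (fun x => (x.2, x.1))
         (fun x => (F x.1 x.2)%:E)).
split => [[k t] []//|[k t] [k' t'] _ _ [-> ->]//|[t k] _ /=].
by exists (k, t).
Qed.

(** In the lemmas on double families, absolute summability is stated in the
    iterated form: the sum over [t] of [asum (F t)] is finite. *)
Lemma exchange_bound T K (F : T -> K -> R) (M : T -> R) :
  (forall t, asum (F t) <= `|M t|%:E)%E ->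
  (\esum_(t in setT) asum (F t) <= asum M)%E.
Proof. by move=> FM; apply: le_esum => t _; exact: FM. Qed.

Section Exchange.
Variables (T K : choiceType) (F : T -> K -> R).
Hypothesis Foo : (\esum_(t in setT) asum (F t) < +oo)%E.

Lemma exchange_row t : (asum (F t) < +oo)%E.
Proof.
apply: le_lt_trans Foo; apply: esum_ge; exists [set t]; first by split.
by rewrite fsbig_set1.
Qed.

Lemma exchange_swap : (\esum_(k in setT) asum (F^~ k) < +oo)%E.
Proof. by rewrite /asum -(@esum_exchange _ _ (fun t k => `|F t k|)). Qed.

Lemma asum_tsum : (asum (fun t => tsum (F t)) <= \esum_(t in setT) asum (F t))%E.
Proof.
apply: le_esum => t _.
have [M M0 EM] := asum_fineP (exchange_row t).
by rewrite EM lee_fin tsum_norm// EM.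
Qed.
End Exchange.

(** Any decomposition into a difference of two summable nonnegative families
    computes the sum, not only the one by positive and negative parts. *)
Lemma tsum_split T (f g h : T -> R) : (forall t, 0 <= g t) -> (forall t, 0 <= h t) ->
  (\esum_(t in setT) (g t)%:E < +oo)%E -> (\esum_(t in setT) (h t)%:E < +oo)%E ->
  (forall t, f t = g t - h t) ->
  tsum f = fine (\esum_(t in setT) (g t)%:E) - fine (\esum_(t in setT) (h t)%:E).
Proof.
move=> g0 h0 goo hoo fE.
have aE (u : T -> R) : (forall t, 0 <= u t) -> asum u = \esum_(t in setT) (u t)%:E.
  by move=> u0; apply: eq_esum => t _; rewrite ger0_norm.
have tE (u : T -> R) : (forall t, 0 <= u t) ->
    tsum u = fine (\esum_(t in setT) (u t)%:E).
  move=> u0; rewrite /tsum [X in _ - fine X]esum1 ?subr0 => [|t _]; last first.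
    by rewrite max_r// oppr_le0.
  by congr fine; apply: eq_esum => t _; rewrite max_l.
rewrite -!tE// (eq_tsum fE) tsumD ?asumN ?aE//; congr (_ + _).
by rewrite -mulN1r -tsumZ ?aE//; apply: eq_tsum => t; rewrite mulN1r.
Qed.

(** Fubini for absolutely summable double families. *)
Lemma tsum_exchange T K (F : T -> K -> R) :
  (\esum_(t in setT) asum (F t) < +oo)%E ->
  tsum (fun t => tsum (F t)) = tsum (fun k => tsum (F^~ k)).
Proof.
move=> Foo; have Foo' := exchange_swap Foo.
pose P t k := Num.max (F t k) 0; pose N t k := Num.max (- F t k) 0.
have P0 t k : 0 <= P t k by rewrite /P le_max lexx orbT.
have N0 t k : 0 <= N t k by rewrite /N le_max lexx orbT.
have PF t k : P t k <= `|F t k| by rewrite /P ge_max normr_ge0 ler_norm.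
have NF t k : N t k <= `|F t k| by rewrite /N ge_max normr_ge0 -normrN ler_norm.
have fin A (B : choiceType) (G H : A -> B -> R) a :
   (forall k, 0 <= G a k) -> (forall k, G a k <= `|H a k|) -> (asum (H a) < +oo)%E ->
   (fine (\esum_(k in setT) (G a k)%:E))%:E = \esum_(k in setT) (G a k)%:E.
  move=> G0 GH Hoo; rewrite fineK// ge0_fin_numE.
    by apply: le_lt_trans Hoo; apply: le_esum => k _; rewrite lee_fin.
  by apply: esum_ge0 => k _; rewrite lee_fin.
have big1 (G : T -> K -> R) : (forall t k, 0 <= G t k) ->
    (forall t k, G t k <= `|F t k|) ->
    \esum_(t in setT) (fine (\esum_(k in setT) (G t k)%:E))%:E =
    \esum_(t in setT) (\esum_(k in setT) (G t k)%:E).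
  by move=> G0 GF; apply: eq_esum => t _; apply: (fin _ _ _ F) => //; exact: exchange_row.
have big2 (G : T -> K -> R) : (forall t k, 0 <= G t k) ->
    (forall t k, G t k <= `|F t k|) ->
    \esum_(k in setT) (fine (\esum_(t in setT) (G t k)%:E))%:E =
    \esum_(k in setT) (\esum_(t in setT) (G t k)%:E).
  move=> G0 GF; apply: eq_esum => k _.
  apply: (fin _ _ (fun k t => G t k) (fun k t => F t k)) => //.
  exact: (exchange_row Foo').
have lt1 (G : T -> K -> R) : (forall t k, 0 <= G t k) ->
    (forall t k, G t k <= `|F t k|) ->
    (\esum_(t in setT) (\esum_(k in setT) (G t k)%:E) < +oo)%E.
  move=> G0 GF; apply: le_lt_trans Foo; apply: le_esum => t _; apply: le_esum => k _.
  by rewrite lee_fin.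
rewrite (@tsum_split _ _ (fun t => fine (\esum_(k in setT) (P t k)%:E))
  (fun t => fine (\esum_(k in setT) (N t k)%:E))) ?big1 ?lt1//; last 2 first.
- by move=> t; rewrite fine_ge0// esum_ge0// => k _; rewrite lee_fin.
- by move=> t; rewrite fine_ge0// esum_ge0// => k _; rewrite lee_fin.
have lt2 (G : T -> K -> R) : (forall t k, 0 <= G t k) ->
    (forall t k, G t k <= `|F t k|) ->
    (\esum_(k in setT) (fine (\esum_(t in setT) (G t k)%:E))%:E < +oo)%E.
  by move=> G0 GF; rewrite (big2 _ G0 GF) -(esum_exchange G0); exact: lt1.
rewrite [RHS](@tsum_split _ _ (fun k => fine (\esum_(t in setT) (P t k)%:E))
  (fun k => fine (\esum_(t in setT) (N t k)%:E)) _ _ (lt2 _ P0 PF) (lt2 _ N0 NF)) //.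
- by rewrite (big2 _ P0 PF) (big2 _ N0 NF) -(esum_exchange P0) -(esum_exchange N0).
- by move=> t; rewrite fine_ge0// esum_ge0// => k _; rewrite lee_fin.
- by move=> t; rewrite fine_ge0// esum_ge0// => k _; rewrite lee_fin.
Qed.
End UnorderedSums.

(** * Multi-indices, formal power series and weights *)

Section MultiIndices.
Variable d : nat.
Local Notation mi := {ffun 'I_d -> nat}.
Implicit Types (a b : mi) (i : 'I_d).

Definition madd a b : mi := [ffun i => (a i + b i)%N].
Definition msub a b : mi := [ffun i => (a i - b i)%N].
Definition mle a b := [forall i, (a i <= b i)%N].
Definition mi0 : mi := [ffun=> 0%N].
(** The exponent of the single variable [i]. *)
Definition mdelta i : mi := [ffun j => (j == i : nat)].
(** The total degree. *)
Definition mdeg a := (\sum_(i < d) a i)%N.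
(** The product of the binomial coefficients of the entries. *)
Definition mbin a b := (\prod_(i < d) 'C(a i, b i))%N.

Lemma mleP a b : reflect (forall i, (a i <= b i)%N) (mle a b).
Proof. exact: forallP. Qed.

Lemma msubK a b : mle b a -> madd b (msub a b) = a.
Proof. by move=> /mleP h; apply/ffunP => i; rewrite !ffunE subnKC. Qed.

Lemma maddK a b : msub (madd a b) a = b.
Proof. by apply/ffunP => i; rewrite !ffunE addKn. Qed.

Lemma maddC a b : madd a b = madd b a.
Proof. by apply/ffunP => i; rewrite !ffunE addnC. Qed.

Lemma mle_addr a b : mle a (madd a b).
Proof. by apply/mleP => i; rewrite ffunE leq_addr. Qed.

Lemma mdegD a b : mdeg (madd a b) = (mdeg a + mdeg b)%N.
Proof. by rewrite /mdeg -big_split; apply: eq_bigr => i _; rewrite ffunE. Qed.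

Lemma mdeg_delta i : mdeg (mdelta i) = 1%N.
Proof.
rewrite /mdeg (bigD1 i)//= ffunE eqxx big1 ?addn0// => j /negPf h.
by rewrite ffunE h.
Qed.

Lemma mdeg0 : mdeg mi0 = 0%N.
Proof. by rewrite /mdeg big1// => i _; rewrite ffunE. Qed.

Lemma mdeg_eq0 a : mdeg a = 0%N -> a = mi0.
Proof.
move=> /eqP; rewrite sum_nat_eq0 => /forallP h.
by apply/ffunP => i; rewrite ffunE; apply/eqP; exact: h.
Qed.

Lemma leq_mdeg a i : (a i <= mdeg a)%N.
Proof. by rewrite /mdeg (bigD1 i)//= leq_addr. Qed.

Lemma mdelta_sub a i : (0 < a i)%N -> madd (msub a (mdelta i)) (mdelta i) = a.
Proof.
move=> ai; apply/ffunP => j; rewrite !ffunE; case: eqP => [->|_].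
  by rewrite subnK.
by rewrite subn0 addn0.
Qed.

Lemma mdeg_pos a : (0 < mdeg a)%N -> exists i, (0 < a i)%N.
Proof.
move=> h; apply/existsP; apply/contraT; rewrite negb_exists => /forallP h0.
by move: h; rewrite /mdeg big1// => i _; apply/eqP; rewrite -leqn0 leqNgt h0.
Qed.

(** The multi-indices all of whose entries are less than [n]. *)
Definition cube n : seq mi :=
  [seq [ffun i => nat_of_ord (b i)] | b : {ffun 'I_d -> 'I_n}].

Lemma cube_uniq n : uniq (cube n).
Proof.
rewrite map_inj_uniq ?enum_uniq// => x y /ffunP h; apply/ffunP => i.
by have := h i; rewrite !ffunE => /val_inj.
Qed.

Lemma mem_cube n a : (a \in cube n) = [forall i, a i < n]%N.
Proof.
apply/mapP/forallP => [[b _ ->] i|h]; first by rewrite ffunE.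
exists [ffun i => Ordinal (h i)]; first by rewrite mem_enum.
by apply/ffunP => i; rewrite !ffunE.
Qed.

(** The multi-indices [b] with [mle b a], as a sequence to sum over. *)
Definition below a := [seq b <- cube (mdeg a).+1 | mle b a].

Lemma below_uniq a : uniq (below a).
Proof. by rewrite filter_uniq// cube_uniq. Qed.

Lemma mem_below a b : (b \in below a) = mle b a.
Proof.
rewrite mem_filter mem_cube; case: (boolP (mle b a)) => //= /mleP h.
by apply/forallP => i; rewrite ltnS (leq_trans (h i))// leq_mdeg.
Qed.

Lemma below0 : below mi0 = [:: mi0].
Proof.
apply: perm_small_eq => //; apply: uniq_perm => // [|b]; first exact: below_uniq.
rewrite mem_below inE; apply/mleP/eqP => [h|-> //].
by apply/ffunP => i; have := h i; rewrite ffunE leqn0 => /eqP.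
Qed.

Lemma sub_cube (s : seq mi) : exists n, {subset s <= cube n}.
Proof.
elim: s => [|a s [n h]]; first by exists 0%N.
exists (maxn n (mdeg a).+1) => b; rewrite inE mem_cube => /orP[/eqP->|/h].
  by apply/forallP => i; rewrite leq_max ltnS leq_mdeg orbT.
by rewrite mem_cube => /forallP hb; apply/forallP => i; rewrite leq_max hb.
Qed.

Lemma cube_sub n m : (n <= m)%N -> {subset cube n <= cube m}.
Proof.
move=> nm a; rewrite !mem_cube => /forallP h; apply/forallP => i.
exact: leq_trans (h i) nm.
Qed.

Variable R : realType.
Implicit Types (c e : mi -> R) (z : 'rV[R]_d).

Lemma big_cube n (F : mi -> R) :
  \sum_(a <- cube n) F a =
  \sum_(b : {ffun 'I_d -> 'I_n}) F [ffun i => nat_of_ord (b i)].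
Proof. by rewrite big_map big_enum. Qed.

Lemma monomialD a b z : monomial (madd a b) z = monomial a z * monomial b z.
Proof.
by rewrite /monomial -big_split; apply: eq_bigr => i _; rewrite ffunE exprD.
Qed.

Lemma monomial0 z : monomial mi0 z = 1.
Proof. by rewrite /monomial big1// => i _; rewrite ffunE expr0. Qed.

Lemma monomial_delta i z : monomial (mdelta i) z = z ord0 i.
Proof.
rewrite /monomial (bigD1 i)//= ffunE eqxx expr1 big1 ?mulr1// => j /negPf h.
by rewrite ffunE h expr0.
Qed.

Lemma monomial_const a (r : R) : monomial a (const_mx r) = r ^+ mdeg a.
Proof.
by rewrite /mdeg expr_sum; apply: eq_bigr => i _; rewrite mxE.
Qed.

Lemma monomial_norm a z (r : R) : (forall i, `|z ord0 i| <= r) ->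
  `|monomial a z| <= r ^+ mdeg a.
Proof.
move=> h; rewrite /monomial normr_prod /mdeg expr_sum; apply: ler_prod => i _.
by rewrite normr_ge0/= normrX lerXn2r ?nnegrE// (le_trans _ (h i)).
Qed.

(** The multivariate binomial formula. *)
Lemma monomial_addE a z z' : monomial a (z + z') =
  \sum_(b <- below a) (mbin a b)%:R * (monomial (msub a b) z * monomial b z').
Proof.
pose N := (mdeg a).+1.
transitivity (\prod_(i < d) \sum_(j < N | (j < (a i).+1)%N)
    'C(a i, j)%:R * (z ord0 i ^+ (a i - j) * z' ord0 i ^+ j)).
  apply: eq_bigr => i _; rewrite mxE exprDn.
  rewrite (big_ord_widen N (fun j => z ord0 i ^+ (a i - j) * z' ord0 i ^+ j *+
    'C(a i, j))) ?ltnS ?leq_mdeg//.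
  by apply: eq_bigr => j _; rewrite mulr_natl.
rewrite bigA_distr_big_dep big_filter big_map big_enum_cond/=.
apply: eq_big => [b|b _].
  by apply/familyP/mleP => h i; have := h i; rewrite ffunE.
rewrite !big_split/= /mbin natr_prod /monomial.
by congr (_ * (_ * _)); apply: eq_bigr => i _; rewrite !ffunE.
Qed.

(** A formal power series is its family of coefficients.  [sconv] is the
    product of two series, [dser i] the derivative in the variable [i]. *)
Definition sconv c e a := \sum_(b <- below a) c b * e (msub a b).
Definition dser i c a := (a i).+1%:R * c (madd a (mdelta i)).

(** The two halves of the Leibniz rule: in a sum over [b] below
    [madd a (mdelta i)], a factor [b i] kills the terms with [b i = 0], and a
    factor [(a i).+1 - b i] those with [b i = (a i).+1]. *)
Lemma sum_below_deltal a i (F : mi -> R) :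
  \sum_(b <- below (madd a (mdelta i))) (b i)%:R * F b =
  \sum_(b <- below a) (b i).+1%:R * F (madd b (mdelta i)).
Proof.
rewrite (bigID (fun b => 0 < b i)%N)/= [X in _ + X]big1 ?addr0; last first.
  by move=> b; rewrite -eqn0Ngt => /eqP ->; rewrite mul0r.
rewrite -big_filter; transitivity
   (\sum_(b <- [seq madd b (mdelta i) | b <- below a]) (b i)%:R * F b); last first.
  by rewrite big_map; apply: eq_bigr => b _; rewrite !ffunE eqxx addn1.
apply: perm_big; apply: uniq_perm.
- by rewrite filter_uniq// below_uniq.
- rewrite map_inj_uniq ?below_uniq// => b b' /ffunP h; apply/ffunP => j.
  by have := h j; rewrite !ffunE => /eqP; rewrite eqn_add2r => /eqP.
move=> b; rewrite mem_filter mem_below; apply/andP/mapP => [[bi /mleP h]|].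
  exists (msub b (mdelta i)); last by rewrite mdelta_sub.
  rewrite mem_below; apply/mleP => j; have := h j; rewrite !ffunE.
  by rewrite leq_subLR addnC.
move=> [b' ]; rewrite mem_below => /mleP h ->; split.
  by rewrite !ffunE eqxx addn1.
by apply/mleP => j; rewrite !ffunE leq_add2r.
Qed.

Lemma sum_below_deltar a i (F : mi -> R) :
  \sum_(b <- below (madd a (mdelta i))) ((a i).+1 - b i)%:R * F b =
  \sum_(b <- below a) ((a i).+1 - b i)%:R * F b.
Proof.
rewrite (bigID (fun b => b i <= a i)%N)/= [X in _ + X]big1 ?addr0; last first.
  by move=> b; rewrite -ltnNge => h; rewrite (eqP (_ : (_ - _ == 0)%N)) ?mul0r.
rewrite -big_filter; apply: perm_big; apply: uniq_perm; rewrite ?below_uniq//.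
  by rewrite filter_uniq// below_uniq.
move=> b; rewrite mem_filter !mem_below; apply/andP/mleP => [[bi /mleP h] j|h].
  have := h j; rewrite !ffunE; case: eqP => [->//|_]; by rewrite addn0.
split; first exact: h.
by apply/mleP => j; rewrite !ffunE (leq_trans (h j))// leq_addr.
Qed.

Lemma dser_sconv i c e a :
  dser i (sconv c e) a = sconv (dser i c) e a + sconv c (dser i e) a.
Proof.
rewrite /dser /sconv mulr_sumr.
transitivity (\sum_(b <- below (madd a (mdelta i)))
  ((b i)%:R * (c b * e (msub (madd a (mdelta i)) b)) +
   ((a i).+1 - b i)%:R * (c b * e (msub (madd a (mdelta i)) b)))).
  rewrite !big_seq; apply: eq_bigr => b; rewrite mem_below => /mleP/(_ i).
  rewrite !ffunE eqxx addn1 => bi.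
  by rewrite -mulrDl -natrD subnKC.
rewrite big_split/= sum_below_deltal sum_below_deltar; congr (_ + _).
  apply: eq_bigr => b _; rewrite mulrA; congr (_ * e _).
  by apply/ffunP => j; rewrite !ffunE subnDr.
rewrite !big_seq; apply: eq_bigr => b; rewrite mem_below => /mleP bi.
rewrite mulrCA !ffunE subSn//; congr (_ * (_ * e _)).
by apply/ffunP => j; rewrite !ffunE addnBAC.
Qed.

Lemma sconv_le c c' e e' a : (forall b, mle b a -> `|c b| <= c' b) ->
  (forall b, mle b a -> `|e b| <= e' b) -> `|sconv c e a| <= sconv c' e' a.
Proof.
move=> hc he; apply: le_trans (ler_norm_sum _ _ _) _.
rewrite big_seq [leRHS]big_seq; apply: ler_sum => b; rewrite mem_below => ba.
rewrite normrM ler_pM// ?hc// he//; apply/mleP => i.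
by rewrite ffunE leq_subr.
Qed.

(** Product and derivative of formal power series in one variable. *)
Definition nconv (g h : nat -> R) n := \sum_(j < n.+1) g j * h (n - j)%N.
Definition nder (g : nat -> R) n := n.+1%:R * g n.+1.

Lemma nder_nconv g h n : nder (nconv g h) n = nconv (nder g) h n + nconv g (nder h) n.
Proof.
rewrite /nder /nconv mulr_sumr.
transitivity (\sum_(j < n.+2) (j%:R * (g j * h (n.+1 - j)%N) +
   (n.+1 - j)%:R * (g j * h (n.+1 - j)%N))).
  by apply: eq_bigr => j _; rewrite -mulrDl -natrD subnKC// -ltnS.
rewrite big_split/= big_ord_recl mul0r add0r [X in _ + X]big_ord_recr/=.
rewrite subnn mul0r addr0; congr (_ + _).
  by apply: eq_bigr => j _; rewrite mulrA subSS.
apply: eq_bigr => j _; rewrite mulrCA subSn//; last by rewrite -ltnS.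
Qed.

(** [wt l a] is the coefficient of the monomial [a] in the [mdeg a]-th power of
    the linear form with coefficients [l]. *)
Definition wt (l : 'I_d -> R) a :=
  (mdeg a)`!%:R / (\prod_(i < d) (a i)`!)%:R * \prod_(i < d) l i ^+ a i.
(** The series of the composite of the one-variable series [g] with the linear
    form with coefficients [l]. *)
Definition majs l (g : nat -> R) a := g (mdeg a) * wt l a.

Lemma wt0 l : wt l mi0 = 1.
Proof.
rewrite /wt mdeg0 fact0 !big1 ?divr1 ?mulr1// => i _; rewrite ffunE ?expr0//.
Qed.

Lemma wtS l a i : (a i).+1%:R * wt l (madd a (mdelta i)) =
  (mdeg a).+1%:R * l i * wt l a.
Proof.
rewrite /wt mdegD mdeg_delta addn1 factS natrM.
have -> : (\prod_(j < d) ((madd a (mdelta i)) j)`! = (a i).+1 * \prod_(j < d) (a j)`!)%N.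
  rewrite (bigD1 i)//= [in RHS](bigD1 i)//= !ffunE eqxx addn1 factS mulnA.
  by congr (_ * _)%N; apply: eq_bigr => j /negPf h; rewrite !ffunE h addn0.
have -> : \prod_(j < d) l j ^+ (madd a (mdelta i)) j = l i * \prod_(j < d) l j ^+ a j.
  rewrite (bigD1 i)//= [in RHS](bigD1 i)//= !ffunE eqxx addn1 exprS mulrA.
  by congr (_ * _); apply: eq_bigr => j /negPf h; rewrite !ffunE h addn0.
rewrite natrM; set P := (\prod_(j < d) _)%N.
have P0 : P%:R != 0 :> R.
  by rewrite pnatr_eq0 -lt0n prodn_gt0// => j; rewrite fact_gt0.
have a0 : (a i).+1%:R != 0 :> R by rewrite pnatr_eq0.
by field; rewrite P0 -natr1 in a0 *; rewrite addrC in a0.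
Qed.

Lemma dser_majs i l g a : dser i (majs l g) a = l i * majs l (nder g) a.
Proof.
rewrite /dser /majs /nder mulrCA wtS mdegD mdeg_delta addn1; ring.
Qed.

(** Composition with a linear form is multiplicative.  The proof is by
    induction on the degree: both sides satisfy the same Leibniz rule, and a
    coefficient of positive degree is determined by one of the derivatives. *)
Lemma sconv_majs l g h a : sconv (majs l g) (majs l h) a = majs l (nconv g h) a.
Proof.
move: {-1}(mdeg a) (erefl (mdeg a)) => n; elim: n a g h => [|n IHn] a g h an.
  rewrite (mdeg_eq0 an) /sconv below0 big_seq1.
  have -> : msub mi0 mi0 = mi0 by apply/ffunP => i; rewrite !ffunE.
  by rewrite /majs wt0 !mulr1 mdeg0 /nconv big_ord1.
have /mdeg_pos[i ai] : (0 < mdeg a)%N by rewrite an.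
pose a' := msub a (mdelta i); have aE : madd a' (mdelta i) = a by rewrite mdelta_sub.
have a'n : mdeg a' = n.
  by apply/eqP; rewrite -(eqn_add2r 1) -(mdeg_delta i) -mdegD aE an mdeg_delta addn1.
have : dser i (sconv (majs l g) (majs l h)) a' = dser i (majs l (nconv g h)) a'.
  rewrite dser_sconv dser_majs.
  have -> : sconv (dser i (majs l g)) (majs l h) a' =
      l i * sconv (majs l (nder g)) (majs l h) a'.
    by rewrite /sconv mulr_sumr; apply: eq_bigr => b _; rewrite dser_majs mulrA.
  have -> : sconv (majs l g) (dser i (majs l h)) a' =
      l i * sconv (majs l g) (majs l (nder h)) a'.
    by rewrite /sconv mulr_sumr; apply: eq_bigr => b _; rewrite dser_majs mulrCA.
  by rewrite !IHn// /majs nder_nconv; ring.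
rewrite /dser aE => /mulfI; apply.
by rewrite pnatr_eq0.
Qed.

Lemma wt_ge0 l a : (forall i, 0 <= l i) -> 0 <= wt l a.
Proof.
by move=> l0; rewrite mulr_ge0 ?divr_ge0 ?prodr_ge0// => i _; rewrite exprn_ge0.
Qed.

Lemma wt_ge l a (r : R) : 0 <= r -> (forall i, r <= l i) -> r ^+ mdeg a <= wt l a.
Proof.
move=> r0 rl; rewrite /wt -[leLHS]mul1r ler_pM ?exprn_ge0//.
  rewrite ler_pdivlMr ?mul1r ?ler_nat ?ltr0n ?prodn_gt0// => [|i]; last first.
    by rewrite fact_gt0.
  rewrite /mdeg; apply: (big_ind2 (fun x y => x <= y`!)%N) => //.
  move=> x m y n xm yn; apply: leq_trans (leq_mul xm yn) _.
  by rewrite -(bin_fact (leq_addr n m)) addKn leq_pmull// bin_gt0 leq_addr.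
rewrite /mdeg expr_sum; apply: ler_prod => i _.
by rewrite exprn_ge0//= lerXn2r ?nnegrE// (le_trans r0).
Qed.

Lemma multinomial_le (s : seq 'I_d) a : ((\sum_(i <- s) a i)%N`! <=
  2 ^ (size s * \sum_(i <- s) a i) * \prod_(i <- s) (a i)`!)%N.
Proof.
elim: s => [|i s IHs]; first by rewrite !big_nil.
rewrite !big_cons /=; set S := (\sum_(j <- s) _)%N in IHs *.
rewrite -(bin_fact (leq_addr S (a i))) addKn.
have hb : ('C(a i + S, a i) <= 2 ^ (a i + S))%N.
  rewrite -[2%N]/(1 + 1)%N expnDn (bigD1 (inord (a i) : 'I_(a i + S).+1))//=.
  by rewrite inordK ?ltnS ?leq_addr// !exp1n !muln1 leq_addr.
apply: leq_trans (leq_mul hb (leq_mul (leqnn _) IHs)) _.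
rewrite [X in (_ * X <= _)%N]mulnCA mulnA leq_mul//.
by rewrite mulSn [leqRHS]expnD leq_mul// leq_exp2l// leq_mul2l leq_addl orbT.
Qed.

Lemma wt_le l a (L : R) : (forall i, 0 <= l i) -> (forall i, l i <= L) ->
  wt l a <= ((2 ^ d)%:R * L) ^+ mdeg a.
Proof.
move=> l0 lL; rewrite /wt exprMn ler_pM ?divr_ge0 ?prodr_ge0//.
- by move=> i _; rewrite exprn_ge0.
- rewrite ler_pdivrMr ?ltr0n ?prodn_gt0// => [|i]; last by rewrite fact_gt0.
  rewrite -natrX -natrM ler_nat -expnM; have := multinomial_le (index_enum 'I_d) a.
  by rewrite -[X in size X]enumT size_enum_ord.
rewrite /mdeg expr_sum; apply: ler_prod => i _.
by rewrite exprn_ge0//= lerXn2r ?nnegrE// (le_trans (l0 i)).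
Qed.

Lemma asum_geom (q : R) : 0 <= q < 1 ->
  (asum (fun a : mi => q ^+ mdeg a)%R <= ((1 - q)^-1 ^+ d)%:E)%E.
Proof.
move=> /andP[q0 q1]; apply: asum_le => s us.
have [n sn] := sub_cube s.
apply: (@le_trans _ _ (\sum_(a <- cube n) q ^+ mdeg a)).
  rewrite [leRHS](bigID (mem s))/= -[leLHS]addr0 lerD//; last first.
    by apply: sumr_ge0 => a _; rewrite exprn_ge0.
  rewrite -[leRHS]big_filter le_eqVlt; apply/orP; left; apply/eqP.
  rewrite (eq_bigr (fun a => q ^+ mdeg a)) => [|a _]; last first.
    by rewrite ger0_norm// exprn_ge0.
  apply: perm_big; apply: uniq_perm => //; first by rewrite filter_uniq// cube_uniq.
  by move=> t; rewrite mem_filter; case: (boolP (_ \in s)) => //= /sn ->.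
rewrite big_cube (eq_bigr (fun b : {ffun 'I_d -> 'I_n} => \prod_(i < d) q ^+ b i)); last first.
  by move=> b _; rewrite /mdeg expr_sum; apply: eq_bigr => i _; rewrite ffunE.
rewrite -(bigA_distr_bigA (fun _ (j : 'I_n) => q ^+ j)).
have le1 : \sum_(j < n) q ^+ j <= (1 - q)^-1.
  rewrite -[leRHS]mul1r ler_pdivlMr ?subr_gt0// mulrC.
  have -> : (1 - q) * \sum_(j < n) q ^+ j = 1 - q ^+ n.
    by rewrite -{2}(expr1n _ n) subrXX; congr (_ * _); apply: eq_bigr => j _; rewrite expr1n mul1r.
  by rewrite lerBlDr lerDl exprn_ge0.
apply: (@le_trans _ _ (\prod_(i < d) (1 - q)^-1)).
  by apply: ler_prod => i _; rewrite le1 sumr_ge0// => j _; rewrite exprn_ge0.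
by rewrite prodr_const card_ord.
Qed.
End MultiIndices.

(** * Convergent power series and analytic functions *)

Section PowerSeries.
Variables (R : realType) (d : nat).
Local Notation mi := {ffun 'I_d -> nat}.
Local Notation V := 'rV[R]_d.
Implicit Types (a b : mi) (i : 'I_d) (c e : mi -> R) (p x y z : V) (g : V -> R).

(** The value at [z] of the power series with coefficients [c]. *)
Definition pser c z := tsum (fun a => c a * monomial a z).
(** Absolute convergence at the point all of whose coordinates are [rho], hence
    on the closed box of radius [rho]. *)
Definition abs_at c (rho : R) := (asum (fun a => (c a * rho ^+ mdeg a)%R) < +oo)%E.
Definition in_box p (rho : R) x := forall i, `|x ord0 i - p ord0 i| < rho.

(** Near [p], the function [g] is the sum of the power series [c] centred at
    [p]. *)
Definition has_series g p c := exists2 rho, 0 < rho &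
  abs_at c rho /\ forall x, in_box p rho x -> g x = pser c (x - p).

Lemma nearP p (P : V -> Prop) : (\forall x \near p, P x) <->
  exists2 r : R, 0 < r & forall x, in_box p r x -> P x.
Proof.
split=> [/nbhs_ballP[r r0 h]|[r r0 h]].
  exists r => // x xr; apply: h; split => // i j; rewrite (ord1 i).
  by rewrite /ball/= distrC; exact: xr.
apply/nbhs_ballP; exists r => // x [_ xr]; apply: h => i.
by have := xr ord0 i; rewrite /ball/= distrC.
Qed.

Lemma in_box0 p (r : R) : 0 < r -> in_box p r p.
Proof. by move=> r0 i; rewrite subrr normr0. Qed.

Lemma in_boxW p (r r' : R) x : r' <= r -> in_box p r' x -> in_box p r x.
Proof. by move=> rr h i; apply: lt_le_trans (h i) rr. Qed.

Lemma in_boxB p (r : R) x : in_box p r x -> forall i, `|(x - p) ord0 i| <= r.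
Proof. by move=> h i; rewrite !mxE ltW. Qed.

Lemma abs_at_pser c rho z : (forall i, `|z ord0 i| <= rho) -> abs_at c rho ->
  (asum (fun a => c a * monomial a z)%R < +oo)%E.
Proof.
move=> zr; apply: le_lt_trans; apply: le_asum => a; rewrite !normrM ler_wpM2l//.
by apply: le_trans (monomial_norm a zr) _; exact: ler_norm.
Qed.

Lemma abs_atW c (r r' : R) : 0 <= r' <= r -> abs_at c r -> abs_at c r'.
Proof.
move=> /andP[r0 rr]; apply: le_lt_trans; apply: le_asum => a.
have r0' := le_trans r0 rr.
by rewrite !normrM ler_wpM2l// !ger0_norm ?exprn_ge0// lerXn2r.
Qed.

Lemma has_series_near g g' p c : (\forall x \near p, g x = g' x) ->
  has_series g p c -> has_series g' p c.
Proof.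
move=> /nearP[r r0 h] [rho rho0 [crho gE]].
have m0 : 0 < Num.min r rho by rewrite lt_min r0.
exists (Num.min r rho) => //; split.
  by apply: abs_atW crho; rewrite (ltW m0) ge_min lexx orbT.
move=> x xm; rewrite -h ?gE//; apply: in_boxW xm; by rewrite ge_min lexx ?orbT.
Qed.

Lemma has_series_val g p c : has_series g p c -> g p = c (mi0 d).
Proof.
move=> [rho rho0 [_ ->]]; last exact: in_box0.
rewrite subrr /pser (@tsum_supp _ _ _ [:: mi0 d])// => [|a].
  by rewrite big_seq1 monomial0 mulr1.
rewrite inE => a0; have /mdeg_pos[i ai] : (0 < mdeg a)%N.
  by rewrite lt0n; apply: contra a0 => /eqP/mdeg_eq0 ->.
by rewrite /monomial (bigD1 i)//= mxE expr0n eqn0Ngt ai mul0r mulr0.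
Qed.

Lemma cubical_cvg (f : mi -> R) : (asum f < +oo)%E ->
  (fun n : nat => \sum_(b : {ffun 'I_d -> 'I_n}) f [ffun i => nat_of_ord (b i)])
    @ \oo --> tsum f.
Proof.
move=> foo; apply/cvgrPdist_le => e e0; have [s us h] := tsumP foo e0.
have [n sn] := sub_cube s; exists n => // m /= nm.
rewrite distrC -big_cube; apply: h; first exact: cube_uniq.
by move=> a /sn/(cube_sub nm).
Qed.

Lemma analytic_atP g p : analytic_at g p <-> exists c, has_series g p c.
Proof.
split=> [[c /nearP[r r0 h]]|[c [rho rho0 [crho gE]]]]; exists c.
  have r20 : 0 < r / 2 by lra.
  exists (r / 2) => //.
  have abs : abs_at c (r / 2).
    have [|+ _] := h (p + const_mx (r / 2)).
      by move=> i; rewrite !mxE addrAC subrr add0r gtr0_norm//; lra.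
    rewrite addrAC subrr add0r; congr (_ < _)%E; apply: eq_esum => a _.
    by rewrite monomial_const.
  split => // x xr; have [|_ hx] := h x; first by apply: in_boxW xr; lra.
  apply: cvg_unique hx _ => //.
  exact: (cubical_cvg (abs_at_pser (in_boxB xr) abs)).
apply/nearP; exists rho => // x xr.
have fin := abs_at_pser (in_boxB xr) crho.
by split => //; rewrite gE//; exact: (cubical_cvg fin).
Qed.

Lemma has_series2 g g' p c c' : has_series g p c -> has_series g' p c' ->
  exists2 r, 0 < r & [/\ abs_at c r, abs_at c' r & forall x, in_box p r x ->
    g x = pser c (x - p) /\ g' x = pser c' (x - p)].
Proof.
move=> [r r0 [cr gE]] [r' r0' [cr' gE']].
have m0 : 0 < Num.min r r' by rewrite lt_min r0.
exists (Num.min r r') => //; split.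
- by apply: abs_atW cr; rewrite (ltW m0) ge_min lexx.
- by apply: abs_atW cr'; rewrite (ltW m0) ge_min lexx orbT.
move=> x xm; rewrite gE ?gE'//; apply: in_boxW xm; by rewrite ge_min lexx ?orbT.
Qed.

Lemma has_seriesD g g' p c c' : has_series g p c -> has_series g' p c' ->
  has_series (fun x => g x + g' x) p (fun a => c a + c' a).
Proof.
move=> hg hg'; have [r r0 [cr cr' gE]] := has_series2 hg hg'.
exists r => //; split.
  by have := asumD cr cr'; congr (_ < _)%E; apply: eq_asum => a; rewrite mulrDl.
move=> x xr; have [-> ->] := gE x xr; rewrite /pser -tsumD; last 2 first.
- exact: abs_at_pser (in_boxB xr) cr.
- exact: abs_at_pser (in_boxB xr) cr'.
by apply: eq_tsum => a; rewrite mulrDl.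
Qed.

Lemma has_seriesZ g p c (k : R) : has_series g p c ->
  has_series (fun x => k * g x) p (fun a => k * c a).
Proof.
move=> [r r0 [cr gE]]; exists r => //; split.
  by have := asumZ_fin k cr; congr (_ < _)%E; apply: eq_asum => a; rewrite mulrA.
move=> x xr; rewrite gE// /pser -tsumZ; last exact: abs_at_pser (in_boxB xr) cr.
by apply: eq_tsum => a; rewrite mulrA.
Qed.

Lemma has_seriesB g g' p c c' : has_series g p c -> has_series g' p c' ->
  has_series (fun x => g x - g' x) p (fun a => c a - c' a).
Proof.
move=> hg /(has_seriesZ (-1)) hg'; have := has_seriesD hg hg'.
by under eq_fun do rewrite mulN1r; under [in X in has_series _ _ X]eq_fun do rewrite mulN1r.
Qed.

Lemma has_series_cst p (k : R) :
  has_series (fun=> k) p (fun a => if a == mi0 d then k else 0).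
Proof.
have z (r : mi -> R) : forall a, a \notin [:: mi0 d] ->
    (if a == mi0 d then k else 0) * r a = 0.
  by move=> a; rewrite inE => /negPf ->; rewrite mul0r.
exists 1 => //; split; first exact: asum_supp_fin (z _).
move=> x _; rewrite /pser (tsum_supp _ (z _))//.
by rewrite big_seq1 eqxx monomial0 mulr1.
Qed.

Section Cauchy.
Variables f h : mi -> R.
Hypotheses (foo : (asum f < +oo)%E) (hoo : (asum h < +oo)%E).
(* The term [f a * h b] of the product of the sums, placed at the index
   [k = madd a b]. *)
Let F a k := if mle a k then f a * h (msub k a) else 0.

Let zeroF a k : (forall b, madd a b <> k) -> F a k = 0.
Proof.
move=> hk; rewrite /F; case: ifP => // ak.
by have := hk (msub k a); rewrite msubK.
Qed.

Let inj_madd a : injective (madd a).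
Proof. by move=> b b' /(congr1 (fun k => msub k a)); rewrite !maddK. Qed.

Let FE a : F a \o madd a =1 (fun b => f a * h b).
Proof. by move=> b; rewrite /= /F mle_addr maddK. Qed.

Let Foo : (\esum_(a in setT) asum (F a) < +oo)%E.
Proof.
apply: (@le_lt_trans _ _ (asum (fun a => fine (asum h) * f a))).
  apply: exchange_bound => a.
  rewrite (asum_inj (@inj_madd a) (@zeroF a)) (eq_asum (FE a)).
  apply: le_trans (asumZ _ hoo) _.
  by rewrite lee_fin normrM mulrC ler_wpM2r// ler_norm.
exact: asumZ_fin.
Qed.

Let colF k : tsum (F^~ k) = \sum_(a <- below k) f a * h (msub k a).
Proof.
rewrite (@tsum_supp _ _ _ (below k)) ?below_uniq// => [|a].
  by rewrite !big_seq; apply: eq_bigr => a; rewrite mem_below /F => ->.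
by rewrite mem_below /F => /negPf ->.
Qed.

(** Exchanging the two summations of [F] groups the products by their index. *)
Lemma cauchy_product : (asum (sconv f h) < +oo)%E /\
  tsum f * tsum h = tsum (sconv f h).
Proof.
split.
  rewrite (@eq_asum _ _ _ (fun k => tsum (F^~ k))); last by move=> k; rewrite colF.
  exact: le_lt_trans (asum_tsum (exchange_swap Foo)) (exchange_swap Foo).
rewrite [RHS](eq_tsum (g := fun k => tsum (F^~ k))); last by move=> k; rewrite colF.
rewrite -tsum_exchange// mulrC -tsumZ//; apply: eq_tsum => a.
rewrite (tsum_inj (@inj_madd a) (@zeroF a)) (eq_tsum (FE a)) tsumZ//.
by rewrite mulrC.
Qed.
End Cauchy.

Lemma sconv_monomial c e z a :
  sconv (fun b => c b * monomial b z) (fun b => e b * monomial b z) a =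
  sconv c e a * monomial a z.
Proof.
rewrite /sconv mulr_suml !big_seq; apply: eq_bigr => b; rewrite mem_below => ba.
by rewrite mulrACA -monomialD msubK.
Qed.

Lemma has_seriesM g g' p c c' : has_series g p c -> has_series g' p c' ->
  has_series (fun x => g x * g' x) p (sconv c c').
Proof.
move=> hg hg'; have [r r0 [cr cr' gE]] := has_series2 hg hg'.
exists r => //; split.
  have [+ _] := cauchy_product cr cr'; congr (_ < _)%E; apply: eq_asum => a.
  rewrite -(monomial_const a r) -sconv_monomial.
  by apply: eq_bigr => b _; rewrite !monomial_const.
move=> x xr; have [-> ->] := gE x xr; rewrite /pser.
have [_ ->] := cauchy_product (abs_at_pser (in_boxB xr) cr) (abs_at_pser (in_boxB xr) cr').
by apply: eq_tsum => a; rewrite sconv_monomial.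
Qed.

(** The coefficients, of index [b], of the series [c] recentred at [z], obtained
    by expanding each monomial of [pser c (z + y)] with the binomial formula. *)
Definition shift_term c z a b := if mle b a then
  (mbin a b)%:R * c a * monomial (msub a b) z else 0.
Definition pshift c z b := tsum (fun a => shift_term c z a b).

Section Shift.
Variables (c : mi -> R) (rho sigma : R) (z : V).
Hypotheses (crho : abs_at c rho) (s0 : 0 <= sigma) (sr : sigma < rho).
Hypothesis zs : forall i, `|z ord0 i| <= sigma.
Let tau := rho - sigma.
Let t0 : 0 < tau. Proof. by rewrite subr_gt0. Qed.

Let term_sum a (y : V) : tsum (fun b => shift_term c z a b * monomial b y) =
  c a * monomial a (z + y).
Proof.
rewrite (@tsum_supp _ _ _ (below a)) ?below_uniq// => [|b]; last first.
  by rewrite mem_below /shift_term => /negPf ->; rewrite mul0r.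
rewrite monomial_addE mulr_sumr !big_seq; apply: eq_bigr => b.
by rewrite mem_below /shift_term => ->; ring.
Qed.

Let row (y : V) : (forall i, `|y ord0 i| <= tau) ->
  (\esum_(a in setT) asum (fun b => (shift_term c z a b * monomial b y)%R) < +oo)%E.
Proof.
move=> yt; apply: le_lt_trans crho; apply: exchange_bound => a.
apply: le_trans (asum_supp (below_uniq a) _) _ => [b|].
  by rewrite mem_below /shift_term => /negPf ->; rewrite mul0r.
rewrite lee_fin -[rho](subrKC sigma) -/tau -(monomial_const a).
have -> : const_mx (sigma + tau) = const_mx sigma + const_mx tau :> V.
  by apply/rowP => i; rewrite !mxE.
rewrite normrM monomial_addE [X in _ <= _ * X]ger0_norm; last first.
  apply: sumr_ge0 => b _; rewrite !monomial_const.
  by rewrite !mulr_ge0 ?exprn_ge0// ltW.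
rewrite mulr_sumr !big_seq; apply: ler_sum => b; rewrite mem_below /shift_term => ->.
rewrite !normrM normr_nat !monomial_const -!mulrA mulrCA ler_wpM2l// ler_wpM2l//.
by rewrite ler_pM// monomial_norm.
Qed.

Lemma abs_shift_term b : (asum (fun a => shift_term c z a b) < +oo)%E.
Proof.
have /row h : forall i, `|(const_mx tau : V) ord0 i| <= tau.
  by move=> i; rewrite mxE ger0_norm// ltW.
have := asumZ_fin (tau ^- mdeg b) (exchange_row (exchange_swap h) b).
congr (_ < _)%E; apply: eq_asum => a; rewrite monomial_const mulrCA mulVf ?mulr1//.
by rewrite expf_neq0// gt_eqF.
Qed.

(** Recentring: a series convergent at radius [rho] can be expanded about any
    point at distance [sigma < rho], with radius [rho - sigma]. *)
Lemma pser_shift : abs_at (pshift c z) tau /\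
  forall y : V, (forall i, `|y ord0 i| <= tau) -> pser c (z + y) = pser (pshift c z) y.
Proof.
have colZ b k : tsum (fun a => shift_term c z a b * k) = pshift c z b * k.
  rewrite [RHS]mulrC -(tsumZ k (abs_shift_term b)).
  by apply: eq_tsum => a; rewrite mulrC.
split=> [|y yt].
  have /row h : forall i, `|(const_mx tau : V) ord0 i| <= tau.
    by move=> i; rewrite mxE ger0_norm// ltW.
  have := le_lt_trans (asum_tsum (exchange_swap h)) (exchange_swap h).
  by congr (_ < _)%E; apply: eq_asum => b; rewrite colZ monomial_const.
rewrite /pser -(eq_tsum (fun a => term_sum a y)) (tsum_exchange (row yt)).
by congr tsum; apply/funext => b; rewrite colZ.
Qed.

End Shift.

Let inj_maddr i : injective (fun b => madd b (mdelta i)).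
Proof.
move=> b b'; rewrite ![madd _ (mdelta i)]maddC.
by move=> /(congr1 (fun k => msub k (mdelta i))); rewrite !maddK.
Qed.

Let shift_term0 c z i a : (forall b, madd b (mdelta i) <> a) ->
  shift_term c z a (mdelta i) = 0.
Proof.
move=> ha; rewrite /shift_term; case: ifP => // ia.
by have := ha (msub a (mdelta i)); rewrite maddC msubK.
Qed.

Let shift_term_delta c z i a :
  shift_term c z (madd a (mdelta i)) (mdelta i) = dser i c a * monomial a z.
Proof.
rewrite /shift_term maddC mle_addr maddK /dser maddC.
congr (_%:R * _ * _); rewrite /mbin (bigD1 i)//= !ffunE eqxx bin1 addn1 big1 ?muln1//.
by move=> j /negPf h; rewrite !ffunE h bin0.
Qed.

Lemma pshift_delta c z i : pshift c z (mdelta i) = pser (dser i c) z.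
Proof.
rewrite /pshift (tsum_inj (@inj_maddr i) (@shift_term0 c z i)).
by apply: eq_tsum => a; exact: shift_term_delta.
Qed.

Lemma abs_dser c (rho sigma : R) i : abs_at c rho -> 0 <= sigma -> sigma < rho ->
  abs_at (dser i c) sigma.
Proof.
move=> crho s0 sr.
have zs j : `|(const_mx sigma : V) ord0 j| <= sigma by rewrite mxE ger0_norm.
have := abs_shift_term crho s0 sr zs (mdelta i).
rewrite (asum_inj (@inj_maddr i) (@shift_term0 c _ i)); congr (_ < _)%E.
by apply: eq_asum => a; rewrite /= shift_term_delta monomial_const.
Qed.

Lemma pser_has_series g p c (rho : R) : 0 < rho -> abs_at c rho ->
  (forall x, in_box p rho x -> g x = pser c (x - p)) ->
  forall x, in_box p (rho / 2) x -> has_series g x (pshift c (x - p)).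
Proof.
move=> r0 crho gE x xr.
have s0 : 0 <= rho / 2 by lra.
have sr : rho / 2 < rho by lra.
have [h1 h2] := pser_shift crho s0 sr (in_boxB xr).
exists (rho - rho / 2); first by lra.
split => // y yx; rewrite gE.
  rewrite -h2; last exact: in_boxB yx.
  by congr (pser c _); rewrite [RHS]addrC addrA subrK.
move=> i; have := ler_distD (x ord0 i) (y ord0 i) (p ord0 i).
move: (xr i) (yx i); lra.
Qed.

(** At the centre, the remainder of order two is [O(h ^ 2)] because the terms of
    degree at least two carry a factor [(h / rho) ^ 2] compared with their value
    at radius [rho]. *)
Lemma has_series_is_derive g p c i : has_series g p c ->
  is_derive p (delta_mx ord0 i) g (c (mdelta i)).
Proof.
move=> hg; have g0 := has_series_val hg.
move: hg => [rho rho0 [crho gE]].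
have [M M0 ME] := asum_fineP crho.
suff cv : (fun h : R => h^-1 *: ((g \o shift p) (h *: delta_mx ord0 i) - g p)) @ 0^'
    --> c (mdelta i).
  by split; [apply/cvg_ex; exists (c (mdelta i))|exact: cvg_lim cv].
apply/cvgrPdist_le => e e0.
have bnd : 0 < e * rho ^+ 2 / (M + 1) by rewrite divr_gt0 ?mulr_gt0 ?exprn_gt0// ltr_wpDl.
near=> h.
have h0 : h != 0 by near: h; exact: nbhs_dnbhs_neq.
have hr : `|h| < rho by near: h; exact: dnbhs0_lt.
have hb : `|h| < e * rho ^+ 2 / (M + 1) by near: h; exact: dnbhs0_lt.
set v : V := h *: delta_mx ord0 i.
have vE j : v ord0 j = if j == i then h else 0.
  by rewrite !mxE eqxx /=; case: eqP => _; rewrite ?mulr1 ?mulr0.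
have vh j : `|v ord0 j| <= `|h| by rewrite vE; case: ifP => _; rewrite ?normr0.
have -> : (g \o shift p) v = pser c v.
  rewrite /= gE ?addrK// => j; rewrite !mxE addrK.
  by have := vh j; rewrite !mxE => /le_lt_trans; exact.
pose f a := c a * monomial a v.
have foo : (asum f < +oo)%E.
  by apply: abs_at_pser crho => j; apply: le_trans (vh j) (ltW hr).
pose s := [:: mi0 d; mdelta i].
have us : uniq s.
  rewrite /= inE andbT; apply/eqP => /(congr1 (@mdeg d)); rewrite mdeg0 mdeg_delta.
  by [].
(* [f1] gathers the terms of indices 0 and [mdelta i], [f2] the others, among
   which those of degree one vanish at [v]. *)
pose f1 a := if a \in s then f a else 0.
pose f2 a := if a \in s then 0 else f a.
have f1s a : a \notin s -> f1 a = 0 by rewrite /f1 => /negPf ->.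
have f2E a : `|f2 a| <= `|h ^+ 2 / rho ^+ 2 * (c a * rho ^+ mdeg a)|.
  rewrite /f2; case: ifP => [_|/negbT]; first by rewrite normr0.
  rewrite !inE negb_or => /andP[a0 ai].
  rewrite /f !normrM mulrCA ler_wpM2l//.
  have [a2|] := leqP 2 (mdeg a).
    apply: le_trans (monomial_norm a vh) _.
    rewrite normfV !normrX (ger0_norm (ltW rho0)) -(subnK a2) addnC !exprD.
    rewrite mulrA divfK ?expf_neq0 ?gt_eqF//.
    by rewrite ler_wpM2l ?exprn_ge0// lerXn2r ?nnegrE ?(ltW rho0) ?(ltW hr).
  rewrite ltnS => a1; have a1' : (0 < mdeg a)%N.
    by rewrite lt0n; apply: contra a0 => /eqP/mdeg_eq0 ->.
  have [j aj] := mdeg_pos a1'.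
  have aE : a = mdelta j.
    rewrite -(mdelta_sub aj); have := congr1 (@mdeg d) (mdelta_sub aj).
    rewrite mdegD mdeg_delta => h1; have /mdeg_eq0 -> : mdeg (msub a (mdelta j)) = 0%N by lia.
    by apply/ffunP => k; rewrite !ffunE.
  rewrite aE monomial_delta vE; case: eqP => [ji|_]; first by rewrite aE ji eqxx in ai.
  by rewrite normr0 mulr_ge0.
have f2b : (asum f2 <= (`|h ^+ 2 / rho ^+ 2| * M)%:E)%E.
  apply: le_trans (le_asum f2E) _; apply: le_trans (asumZ _ crho) _.
  by rewrite /abs_at in ME; rewrite ME.
have -> : pser c v = c (mi0 d) + c (mdelta i) * h + tsum f2.
  transitivity (tsum (fun a => f1 a + f2 a)).
    by apply: eq_tsum => a; rewrite /f1 /f2; case: ifP; rewrite ?addr0 ?add0r.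
  rewrite tsumD; last 2 first.
  - exact: asum_supp_fin us f1s.
  - by apply: le_lt_trans f2b _; rewrite ltry.
  congr (_ + _); rewrite (tsum_supp us f1s) big_cons big_seq1 /f1 !inE !eqxx orbT.
  by rewrite /f monomial0 monomial_delta vE eqxx mulr1.
have -> : c (mdelta i) - h^-1 *: (c (mi0 d) + c (mdelta i) * h + tsum f2 - g p) =
   - (h^-1 * tsum f2).
  by rewrite g0 /GRing.scale /=; field.
rewrite normrN normrM normfV ler_pdivrMl ?normr_gt0//.
apply: le_trans (tsum_norm f2b) _.
have hM : `|h| * M <= e * rho ^+ 2.
  move: hb; rewrite ltr_pdivlMr; last by rewrite ltr_wpDl.
  by move=> /ltW; apply: le_trans; rewrite ler_wpM2l// lerDl.
rewrite normrM normfV !normrX (ger0_norm (ltW rho0)).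
have -> : `|h| ^+ 2 / rho ^+ 2 * M = `|h| * (`|h| * M / rho ^+ 2).
  by rewrite expr2; ring.
by rewrite ler_wpM2l// ler_pdivrMr// exprn_gt0.
Unshelve. all: by end_near.
Qed.

(** Termwise differentiation: away from the centre, the derivative is read on
    the recentred series. *)
Lemma has_series_deriv g p c i : has_series g p c ->
  has_series (fun x => 'D_(delta_mx ord0 i) g x) p (dser i c).
Proof.
move=> [rho r0 [crho gE]]; exists (rho / 2); first by lra.
split; first by apply: abs_dser crho _ _; lra.
move=> x xr; have hs := pser_has_series r0 crho gE xr.
by rewrite -pshift_delta; have [_ ->] := has_series_is_derive i hs.
Qed.

(** The coefficients of a convergent series are determined by its sum. *)
Lemma has_series0 p c : has_series (fun=> 0) p c -> c =1 fun=> 0.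
Proof.
move=> hc a; move: {-1}(mdeg a) (erefl (mdeg a)) => n; elim: n a c hc => [|n IHn] a c hc an.
  by rewrite (mdeg_eq0 an) -(has_series_val hc).
have /mdeg_pos[i ai] : (0 < mdeg a)%N by rewrite an.
have := has_series_deriv i hc.
under eq_fun do rewrite derive_cst.
move=> /(IHn (msub a (mdelta i))); rewrite /dser mdelta_sub//.
have -> : mdeg (msub a (mdelta i)) = n.
  by have := congr1 (@mdeg d) (mdelta_sub ai); rewrite mdegD mdeg_delta; lia.
by move=> /(_ erefl)/eqP; rewrite mulf_eq0 pnatr_eq0 => /eqP.
Qed.

Lemma has_series_uniq g p c c' : has_series g p c -> has_series g p c' -> c =1 c'.
Proof.
move=> h h' a; apply/eqP; rewrite -subr_eq0; apply/eqP.
apply: (@has_series0 p (fun a => c a - c' a)).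
by have := has_seriesB h h'; under eq_fun do rewrite subrr.
Qed.

Lemma has_series_eq g g' p c : has_series g p c -> has_series g' p c ->
  \forall x \near p, g x = g' x.
Proof.
move=> hg hg'; have [r r0 [_ _ h]] := has_series2 hg hg'.
by apply/nearP; exists r => // x /h[-> ->].
Qed.

Lemma has_series_pser c (rho : R) p : 0 < rho -> abs_at c rho ->
  has_series (fun x => pser c (x - p)) p c.
Proof. by move=> r0 cr; exists rho. Qed.
End PowerSeries.

(** * Recursively defined series and the inverse of a series *)

Section TriangularFixpoint.
Variables (R : realType) (X : Type) (r : X -> nat) (G : (X -> R) -> X -> R).
(* The values of [G u] at rank [n] only depend on those of [u] at rank less than
   [n]. *)
Hypothesis G_local : forall n u v, (forall x, (r x < n)%N -> u x = v x) ->
  forall x, (r x < n.+1)%N -> G u x = G v x.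

(** The fixed point of the triangular operator [G]: its value at [x] is final
    after as many iterations as the rank of [x]. *)
Definition trifix x := iter (r x).+1 G (fun=> 0) x.

Let iter_stable n m x : (r x < n)%N -> (n <= m)%N ->
  iter m G (fun=> 0) x = iter n G (fun=> 0) x.
Proof.
elim: n m x => // n IHn [//|m] x xn nm; rewrite !iterS; apply: (G_local _ xn).
by move=> y yn; exact: IHn.
Qed.

Lemma trifixE x : trifix x = G trifix x.
Proof.
rewrite {1}/trifix iterS; apply: (@G_local (r x)) => // y yx.
by rewrite /trifix; exact: iter_stable.
Qed.

Lemma trifix_uniq u v : u =1 G u -> v =1 G v -> u =1 v.
Proof.
move=> uE vE x; have [n] := ubnP (r x); elim: n x => // n IHn x xn.
by rewrite uE vE; apply: (G_local _ xn).
Qed.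

Lemma trifix_ind (Q : X -> R -> Prop) : (forall x, Q x 0) ->
  (forall u, (forall x, Q x (u x)) -> forall x, Q x (G u x)) ->
  forall x, Q x (trifix x).
Proof.
move=> Q0 QG x; rewrite /trifix; move: (_.+1) => n.
by elim: n x => [|n IHn] x //=; apply: QG.
Qed.
End TriangularFixpoint.

Section Inverse.
Variables (R : realType) (d : nat).
Local Notation mi := {ffun 'I_d -> nat}.
Local Notation V := 'rV[R]_d.
Implicit Types (c e : mi -> R) (p x : V) (g : V -> R) (a b : mi).

Lemma abs_at_bound c (rho : R) : 0 < rho -> abs_at c rho ->
  exists2 C, 0 <= C & forall a, `|c a| <= C * rho^-1 ^+ mdeg a.
Proof.
move=> r0 /asum_fineP[M M0 ME]; exists M => // a.
have := @asum_term _ _ _ M a (eq_ind _ (fun y => (y <= M%:E)%E) (lexx _) _ (esym ME)).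
rewrite normrM [X in _ * X <= _]ger0_norm ?exprn_ge0 ?(ltW r0)// => h.
by rewrite exprVn ler_pdivlMr ?exprn_gt0.
Qed.

Lemma bound_abs_at c (C q : R) : 0 <= q -> (forall a, `|c a| <= C * q ^+ mdeg a) ->
  exists2 rho, 0 < rho & abs_at c rho.
Proof.
move=> q0 h; have q1 : 0 < (q + 1) * 2 by lra.
exists ((q + 1) * 2)^-1; first by rewrite invr_gt0.
have C0 : 0 <= C.
  have := h (mi0 d); rewrite mdeg0 expr0 mulr1; exact: le_trans.
apply: (@le_lt_trans _ _ (asum (fun a : mi => C * (2^-1) ^+ mdeg a))).
  apply: le_asum => a; rewrite !normrM [X in _ <= X * _]ger0_norm//.
  have e1 : 0 <= ((q + 1) * 2)^-1 by rewrite invr_ge0 ltW.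
  have e2 : 0 <= 2^-1 :> R by rewrite invr_ge0.
  rewrite (ger0_norm (exprn_ge0 _ e1)) (ger0_norm (exprn_ge0 _ e2)).
  apply: le_trans (ler_wpM2r _ (h a)) _; first by rewrite exprn_ge0 ?invr_ge0 ?ltW.
  rewrite -mulrA ler_wpM2l// -exprMn lerXn2r ?nnegrE ?mulr_ge0//.
  by rewrite ler_pdivrMr// mulrCA mulVf ?pnatr_eq0// mulr1 lerDl.
by apply: asumZ_fin; apply: le_lt_trans (@asum_geom _ _ _ _) (ltry _); lra.
Qed.

Lemma sconv_local c c' e e' a : (forall b, mle b a -> c b = c' b) ->
  (forall b, mle b a -> e b = e' b) -> sconv c e a = sconv c' e' a.
Proof.
move=> hc he; rewrite /sconv !big_seq; apply: eq_bigr => b; rewrite mem_below => ba.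
by rewrite hc// he//; apply/mleP => i; rewrite ffunE leq_subr.
Qed.

Lemma mle0 a : mle (mi0 d) a.
Proof. by apply/mleP => i; rewrite ffunE. Qed.

Lemma msub0 a : msub a (mi0 d) = a.
Proof. by apply/ffunP => i; rewrite !ffunE subn0. Qed.

Section SeriesInverse.
Variable c : mi -> R.
Hypothesis c0 : c (mi0 d) != 0.
Let c' a := if a == mi0 d then 0 else c a.
Let G e a := (c (mi0 d))^-1 * ((a == mi0 d)%:R - sconv c' e a).
(** The inverse of the series [c]: the equation [sconv c e = 1], solved for the
    coefficients of [e] by increasing degree. *)
Definition sinv := trifix (@mdeg d) G.

Let G_local n u v : (forall a, (mdeg a < n)%N -> u a = v a) ->
  forall a, (mdeg a < n.+1)%N -> G u a = G v a.
Proof.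
move=> uv a an; rewrite /G; congr (_ * (_ - _)).
rewrite /sconv !big_seq; apply: eq_bigr => b; rewrite mem_below => ba.
rewrite /c'; case: eqP => [_|/eqP b0]; first by rewrite !mul0r.
congr (_ * _); apply: uv; have := congr1 (@mdeg d) (msubK ba); rewrite mdegD.
have : (0 < mdeg b)%N by rewrite lt0n; apply: contra b0 => /eqP/mdeg_eq0 ->.
lia.
Qed.

Lemma sconv_sinv a : sconv c sinv a = (a == mi0 d)%:R.
Proof.
have : sconv c sinv a = c (mi0 d) * sinv a + sconv c' sinv a.
  rewrite /sconv (bigD1_seq (mi0 d)) ?below_uniq ?mem_below ?mle0//= msub0.
  congr (_ + _); rewrite [RHS](bigD1_seq (mi0 d)) ?below_uniq ?mem_below ?mle0//=.
  rewrite {1}/c' eqxx mul0r add0r; apply: eq_bigr => b /negPf b0.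
  by rewrite /c' b0.
move=> ->; rewrite {1}/sinv (trifixE G_local) -/sinv /G mulrA divff// mul1r.
by rewrite subrK.
Qed.

(** With [s = 1 + C / |c 0|], the inverse is majorized by a multiple of the
    geometric series of ratio [s] composed with [q] times the sum of the
    variables; this ratio is the one for which the recursion preserves the
    bound. *)
Lemma sinv_bound (C q : R) : 0 <= C -> 0 <= q ->
  (forall a, `|c a| <= C * q ^+ mdeg a) ->
  exists C' q', 0 <= q' /\ forall a, `|sinv a| <= C' * q' ^+ mdeg a.
Proof.
move=> C0 q0 cC.
pose k : R := `|c (mi0 d)|^-1; have k0 : 0 <= k by rewrite invr_ge0.
pose s := 1 + C * k; have s1 : 0 <= s by rewrite addr_ge0 ?mulr_ge0.
pose l : 'I_d -> R := fun=> q.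
have wl a : 0 <= wt l a by apply: wt_ge0.
pose h (n : nat) : R := k * s ^+ n.
have bnd a : `|sinv a| <= majs l h a.
  apply: (@trifix_ind R _ (@mdeg d) G
    (fun (a : mi) (y : R) => `|y| <= majs l h a)) => [x|u hu x].
    by rewrite normr0 /majs mulr_ge0 ?wl// /h mulr_ge0 ?exprn_ge0.
  rewrite /G normrM normfV -/k /majs -mulrA ler_wpM2l//.
  pose g (n : nat) : R := if n == 0%N then 0 else C.
  have : `|sconv c' u x| <= majs l (nconv g h) x.
    rewrite -sconv_majs; apply: sconv_le => b _; last exact: hu.
    rewrite /c' /majs /g; case: eqP => [->|/eqP b0].
      by rewrite normr0 mdeg0 eqxx mul0r.
    have /negPf -> : mdeg b != 0%N by apply: contra b0 => /eqP/mdeg_eq0 ->.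
    by apply: le_trans (cC b) _; rewrite ler_wpM2l// wt_ge.
  have -> : majs l (nconv g h) x = (s ^+ mdeg x - 1) * wt l x.
    rewrite /majs; congr (_ * _); rewrite /nconv big_ord_recl /g /= mul0r add0r.
    rewrite (subrX1 s) /s addrAC subrr add0r mulr_sumr.
    rewrite (reindex_inj rev_ord_inj)/=; apply: eq_bigr => j _.
    rewrite /bump /h /s /= mulrA; congr (_ * _ ^+ _).
    have := ltn_ord j; rewrite add1n; lia.
  move=> hs; apply: le_trans (ler_normB _ _) _.
  have [x0|x0] := eqVneq x (mi0 d); last first.
    rewrite normr0 add0r; apply: le_trans hs _.
    by rewrite mulrBl mul1r lerBlDr lerDl.
  move: hs; rewrite x0 mdeg0 expr0 wt0 mulr1 normr1 subrr; lra.
exists k, (s * ((2 ^ d)%:R * q)); split=> [|a]; first by rewrite !mulr_ge0.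
apply: le_trans (bnd a) _; rewrite /majs /h -mulrA ler_wpM2l// exprMn.
by rewrite ler_wpM2l ?exprn_ge0// wt_le.
Qed.
End SeriesInverse.

Lemma has_seriesV g p c : has_series g p c -> g p != 0 ->
  (\forall x \near p, g x != 0) /\
  exists c', has_series (fun x => (g x)^-1) p c'.
Proof.
move=> hg gp0.
have c0 : c (mi0 d) != 0 by rewrite -(has_series_val hg).
have [rho r0 [/(abs_at_bound r0)[C C0 cC] _]] := hg.
have q0 : 0 <= rho^-1 by rewrite invr_ge0 ltW.
have [C' [q' [q'0 cC']]] := sinv_bound c0 C0 q0 cC.
have [r r0' cr] := bound_abs_at q'0 cC'.
have hi := has_series_pser p r0' cr.
have gh : \forall x \near p, g x * pser (sinv c) (x - p) = 1.
  have := has_seriesM hg hi; set e := sconv _ _ => he.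
  apply: (has_series_eq he); have := has_series_cst p 1; congr has_series.
  by apply/funext => a; rewrite /e sconv_sinv//; case: eqP.
have g0 : \forall x \near p, g x != 0.
  apply: filterS gh => x h; apply/eqP => gx.
  by move/eqP: h; rewrite gx mul0r eq_sym oner_eq0.
split => //; exists (sinv c); apply: has_series_near hi.
apply: filterS2 gh g0 => x h gx; apply: (mulfI gx).
by rewrite h divff.
Qed.
End Inverse.

(** * The majorant series with coefficients 1 / (n + 1) ^ 2 *)

Section Majorant.
Variable R : realType.

(** A one-variable series of radius one whose square is bounded, coefficient by
    coefficient, by a multiple of itself. *)
Definition phi (n : nat) : R := (n.+1%:R ^+ 2)^-1.

Lemma phi_ge0 n : 0 <= phi n.
Proof. by rewrite invr_ge0 exprn_ge0. Qed.

Lemma phi_le1 n : phi n <= 1.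
Proof. by rewrite invf_le1 ?exprn_gt0// exprn_ege1// ler1n. Qed.

Lemma phi_ge n : 1 <= 4 ^+ n * phi n.
Proof.
rewrite ler_pdivlMr ?exprn_gt0// mul1r.
elim: n => [|n IHn]; first by rewrite !expr0 expr1n.
have n1 : 1 <= n.+1%:R :> R by rewrite ler1n.
rewrite [leRHS]exprS -[n.+2%:R]natr1; move: IHn n1; nra.
Qed.

Lemma sum_phi n : \sum_(j < n.+1) phi j <= 2 - n.+1%:R^-1.
Proof.
elim: n => [|n IHn]; first by rewrite big_ord1 /phi expr1n invr1; lra.
rewrite big_ord_recr /=; apply: le_trans (lerD IHn (lexx _)) _.
rewrite /phi; have n1 : 1 <= n.+1%:R :> R by rewrite ler1n.
rewrite -[n.+2%:R]natr1; set x := n.+1%:R in n1 *.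
have x0 : 0 < x by lra.
have y0 : 0 < x + 1 by lra.
have h : (x + 1) ^- 2 <= x^-1 - (x + 1)^-1.
  have -> : x^-1 - (x + 1)^-1 = (x * (x + 1))^-1 by field; rewrite !gt_eqF.
  by rewrite lef_pV2 ?posrE ?exprn_gt0 ?mulr_gt0//; nra.
by move: h; move: ((x + 1) ^- 2) (x^-1) ((x + 1)^-1) => u v w; lra.
Qed.

Lemma nconv_phi n : nconv phi phi n <= 8 * phi n.
Proof.
have s2 : \sum_(j < n.+1) phi j <= 2.
  by apply: le_trans (sum_phi n) _; rewrite gerBl invr_ge0.
have s2' : \sum_(j < n.+1) phi (n - j) <= 2.
  rewrite (reindex_inj rev_ord_inj)/=; apply: le_trans s2; apply: ler_sum => j _.
  by have -> : (n - (n.+1 - j.+1) = j)%N by have := ltn_ord j; lia.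
apply: (@le_trans _ _ (2 * phi n * \sum_(j < n.+1) (phi j + phi (n - j)))); last first.
  by rewrite big_split/=; have := phi_ge0 n; nra.
rewrite mulr_sumr; apply: ler_sum => j _; rewrite /phi.
(* With [x = j + 1] and [y = n - j + 1], this is
   [(x + y - 1) ^ 2 <= 2 * (x ^ 2 + y ^ 2)]. *)
have jn : (j <= n)%N by rewrite -ltnS.
have -> : n.+1%:R = (j + (n - j)).+1%:R :> R by rewrite subnKC.
move: (n - j)%N => b; move: (nat_of_ord j) => a.
have a0 : 0 < a.+1%:R :> R by [].
have b0 : 0 < b.+1%:R :> R by [].
have -> : (a + b).+1%:R = a.+1%:R + (b.+1%:R - 1) :> R.
  by rewrite -[b.+1%:R]natr1 addrK -natrD addSn.
have a1 : 1 <= a.+1%:R :> R by rewrite ler1n.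
have b1 : 1 <= b.+1%:R :> R by rewrite ler1n.
move: a.+1%:R b.+1%:R a0 b0 a1 b1 => x y x0 y0 x1 y1.
have s0 : 0 < x + (y - 1) by lra.
have -> : 2 / (x + (y - 1)) ^+ 2 * (x ^- 2 + y ^- 2) =
  (2 * (x ^+ 2 + y ^+ 2)) / ((x + (y - 1)) ^+ 2 * (x ^+ 2 * y ^+ 2)).
  by field; rewrite !gt_eqF.
rewrite ler_pdivlMr ?mulr_gt0 ?exprn_gt0//.
have -> : x ^- 2 / y ^+ 2 * ((x + (y - 1)) ^+ 2 * (x ^+ 2 * y ^+ 2)) =
  (x + (y - 1)) ^+ 2 by field; rewrite !gt_eqF.
have := sqr_ge0 (x - y); nra.
Qed.

Lemma nder_ge0 n : 0 <= nder phi n.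
Proof. by rewrite mulr_ge0// phi_ge0. Qed.

Lemma nconv_phi_nder n : nconv phi (nder phi) n <= 8 * nder phi n.
Proof.
rewrite /nder mulrCA; apply: le_trans (ler_wpM2l _ (nconv_phi n.+1)) => //.
rewrite /nconv [X in _ <= _ * X]big_ord_recr /= mulrDr -[leLHS]addr0 lerD ?mulr_ge0 ?phi_ge0//.
rewrite mulr_sumr; apply: ler_sum => j _.
have jn : (j <= n)%N by rewrite -ltnS.
rewrite mulrCA -subSn// ler_wpM2r ?mulr_ge0 ?phi_ge0// ler_nat.
by rewrite leq_subr.
Qed.

Lemma nconv_le (g g' h h' : nat -> R) n : (forall j, 0 <= g j <= g' j) ->
  (forall j, 0 <= h j <= h' j) -> nconv g h n <= nconv g' h' n.
Proof.
move=> hg hh; apply: ler_sum => j _.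
have /andP[g0 gg] := hg j; have /andP[h0 hh'] := hh (n - j)%N.
exact: ler_pM.
Qed.

Lemma nconv_phi3 n : nconv (nconv phi phi) (nder phi) n <= 64 * nder phi n.
Proof.
apply: (@le_trans _ _ (nconv (fun j => 8 * phi j) (nder phi) n)).
  apply: nconv_le => j; last by rewrite nder_ge0 lexx.
  rewrite nconv_phi andbT; apply: sumr_ge0 => i _; by rewrite mulr_ge0 ?phi_ge0.
have -> : nconv (fun j => 8 * phi j) (nder phi) n = 8 * nconv phi (nder phi) n.
  by rewrite /nconv mulr_sumr; apply: eq_bigr => j _; rewrite mulrA.
have := nconv_phi_nder n; lra.
Qed.
End Majorant.

(** * The Cauchy-Kovalevskaya theorem for cubic quasilinear systems *)

Section CauchyKovalevskaya.
Variables (R : realType) (d : nat) (I : finType).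
Local Notation mi := {ffun 'I_d -> nat}.
Local Notation V := 'rV[R]_d.
Implicit Types (a b : mi) (p x : V).

(** A term of the right-hand side: a constant times the product of two unknowns
    and of a first derivative of an unknown, the unknowns being indexed by [I]. *)
Record cubic := Cubic {
  ccoef : R; cfac1 : I; cfac2 : I; cfac3 : I; cdir : 'I_d }.

(** The sum of the terms [s], evaluated on functions ([cubic_eval]) and on formal
    power series ([cubic_ser]). *)
Definition cubic_eval (s : seq cubic) (U : I -> V -> R) (x : V) :=
  \sum_(t <- s) ccoef t * (U (cfac1 t) x * U (cfac2 t) x *
    'D_(delta_mx ord0 (cdir t)) (U (cfac3 t)) x).

Definition cubic_ser (s : seq cubic) (c : I -> mi -> R) a :=
  \sum_(t <- s) ccoef t * sconv (sconv (c (cfac1 t)) (c (cfac2 t)))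
    (dser (cdir t) (c (cfac3 t))) a.

Lemma has_series_cubic s U c p : (forall i, has_series (U i) p (c i)) ->
  has_series (cubic_eval s U) p (cubic_ser s c).
Proof.
move=> hU; elim: s => [|t s IHs].
  have := has_series_cst p (0 : R).
  have -> : (fun a => if a == mi0 d then 0 else 0 : R) = cubic_ser [::] c.
    by apply/funext => a; rewrite /cubic_ser big_nil; case: ifP.
  by have -> : (fun=> 0) = cubic_eval [::] U by apply/funext => x; rewrite /cubic_eval big_nil.
have := has_seriesD (has_seriesZ (ccoef t) (has_seriesM (has_seriesM (hU (cfac1 t))
  (hU (cfac2 t))) (has_series_deriv (cdir t) (hU (cfac3 t))))) IHs.
congr has_series; apply/funext => x; first by rewrite /cubic_eval big_cons.
by rewrite /cubic_ser big_cons.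
Qed.

(* The system is [D_k (U i) = cubic_eval (rhs i) U], where no derivative in the
   direction [k] occurs on the right. *)
Variables (rhs : I -> seq cubic) (k : 'I_d).
Hypothesis rhs_dir : forall i t, List.In t (rhs i) -> cdir t != k.

(** The system and its initial condition [h] on the plane where the variable [k]
    vanishes, as a recursion on the coefficients by increasing exponent of the
    variable [k]. *)
Definition ck_step (h : I -> mi -> R) (u : I * mi -> R) (x : I * mi) :=
  if x.2 k == 0%N then h x.1 x.2 else
  cubic_ser (rhs x.1) (fun i a => u (i, a)) (msub x.2 (mdelta k)) / (x.2 k)%:R.

Lemma sum_In (s : seq cubic) (F F' : cubic -> R) :
  (forall t, List.In t s -> F t = F' t) -> \sum_(t <- s) F t = \sum_(t <- s) F' t.
Proof.
elim: s => [|t s IHs] h; first by rewrite !big_nil.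
by rewrite !big_cons h ?IHs//; [move=> t' ht'; apply: h; right|left].
Qed.

Lemma ck_local h n u v : (forall x : I * mi, (x.2 k < n)%N -> u x = v x) ->
  forall x : I * mi, (x.2 k < n.+1)%N -> ck_step h u x = ck_step h v x.
Proof.
move=> uv [i a] /= an; rewrite /ck_step /=; case: eqP => // /eqP ak.
congr (_ / _); apply: sum_In => t /rhs_dir tk; congr (_ * _).
have lt b : mle b (msub a (mdelta k)) -> (b k < n)%N.
  move=> /mleP/(_ k); rewrite !ffunE eqxx; move: ak an; lia.
have le b b' : mle b' b -> mle b (msub a (mdelta k)) -> mle b' (msub a (mdelta k)).
  by move=> /mleP h1 /mleP h2; apply/mleP => j; apply: leq_trans (h1 j) (h2 j).
apply: sconv_local => b ba.
  apply: sconv_local => b' b'b; apply: uv => /=; apply: lt; exact: le b'b ba.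
rewrite /dser; congr (_ * _); apply: uv => /=.
by rewrite !ffunE eq_sym (negPf tk) addn0 lt.
Qed.

Lemma cubic_ser_step h (c : I -> mi -> R) :
  (forall i a, c i a = ck_step h (fun y : I * mi => c y.1 y.2) (i, a)) ->
  forall i a, dser k (c i) a = cubic_ser (rhs i) c a.
Proof.
move=> hc i a; rewrite /dser hc /ck_step /= !ffunE eqxx addn1 /=.
by rewrite mulrC divfK ?pnatr_eq0// maddC maddK.
Qed.

Lemma step_cubic_ser (c : I -> mi -> R) h :
  (forall i a, a k = 0%N -> c i a = h i a) ->
  (forall i a, dser k (c i) a = cubic_ser (rhs i) c a) ->
  forall x : I * mi, c x.1 x.2 = ck_step h (fun y : I * mi => c y.1 y.2) x.
Proof.
move=> h0 hc [i a]; rewrite /ck_step /=; case: eqP => [/h0//|/eqP ak].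
have ak' : (0 < a k)%N by rewrite lt0n.
rewrite -hc /dser mdelta_sub// !ffunE eqxx -[X in X.+1]/(a k - 1)%N.
by rewrite subn1 prednK// mulrAC mulfV ?mul1r// pnatr_eq0.
Qed.

(** The formal solution with initial condition [h]. *)
Definition ck_sol h i a := trifix (fun x : I * mi => x.2 k) (ck_step h) (i, a).

Lemma ck_sol_dser h i a : dser k (ck_sol h i) a = cubic_ser (rhs i) (ck_sol h) a.
Proof.
apply: (cubic_ser_step (h := h)) => j b.
rewrite /ck_sol (trifixE (@ck_local h)).
by congr (ck_step h); apply/funext => -[].
Qed.

Lemma ck_sol_init h i a : a k = 0%N -> ck_sol h i a = h i a.
Proof. by move=> ak; rewrite /ck_sol (trifixE (@ck_local h)) /ck_step /= ak eqxx. Qed.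

(** The formal solution is majorized by [C * phi] composed with the linear form
    [r * (sum of the x_i, i <> k) + la * r * x_k].  Its cubic terms are bounded
    by a constant times [64 * C ^ 3] times the derivative of [phi], while the
    derivative of the majorant in the variable [k] gains a factor [la], which is
    chosen large enough. *)
Lemma ck_sol_bound h (C q : R) : 0 <= C -> 0 <= q ->
  (forall i a, `|h i a| <= C * q ^+ mdeg a) ->
  exists q', 0 <= q' /\ forall i a, `|ck_sol h i a| <= C * q' ^+ mdeg a.
Proof.
move=> C0 q0 hb.
pose A : R := \sum_(i : I) \sum_(t <- rhs i) `|ccoef t|.
have A0 : 0 <= A by apply: sumr_ge0 => i _; apply: sumr_ge0.
have iA i : \sum_(t <- rhs i) `|ccoef t| <= A.
  rewrite /A (bigD1 i)//= lerDl; apply: sumr_ge0 => j _; exact: sumr_ge0.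
pose la : R := 1 + 64 * A * C ^+ 2.
have la1 : 1 <= la by rewrite lerDl !mulr_ge0// exprn_ge0.
(* The factor 4 absorbs the decay of [phi] in the bound of the initial data. *)
pose r := 4 * q; have r0 : 0 <= r by rewrite mulr_ge0.
pose l (i : 'I_d) : R := if i == k then la * r else r.
have rl i : r <= l i by rewrite /l; case: ifP => // _; rewrite ler_peMl.
have lr i : l i <= la * r by rewrite /l; case: ifP => // _; rewrite ler_peMl.
have l0 i : 0 <= l i by apply: le_trans (rl i).
have wl a : 0 <= wt l a by apply: wt_ge0.
pose f n : R := C * phi R n.
have bnd (x : I * mi) : `|trifix (fun x : I * mi => x.2 k) (ck_step h) x| <= majs l f x.2.
  apply: (@trifix_ind R _ _ (ck_step h) (fun (x : I * mi) y => `|y| <= majs l f x.2)).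
    by move=> y; rewrite normr0 mulr_ge0// mulr_ge0// phi_ge0.
  move=> u hu [i a]; rewrite /ck_step /=; case: eqP => [_|/eqP ak].
    apply: le_trans (hb i a) _; rewrite /majs /f -mulrA ler_wpM2l//.
    apply: (@le_trans _ _ (phi R (mdeg a) * r ^+ mdeg a)).
      rewrite /r exprMn mulrA mulrC ler_peMr ?exprn_ge0// mulrC.
      exact: phi_ge.
    by rewrite ler_wpM2l ?phi_ge0// wt_ge.
  have ak' : (0 < a k)%N by rewrite lt0n.
  set a' := msub a (mdelta k); have aE : madd a' (mdelta k) = a by rewrite mdelta_sub.
  have aN : mdeg a = (mdeg a').+1 by rewrite -aE mdegD mdeg_delta addn1.
  have term t : List.In t (rhs i) -> `|sconv (sconv (fun a => u (cfac1 t, a))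
      (fun a => u (cfac2 t, a))) (dser (cdir t) (fun a => u (cfac3 t, a))) a'| <=
      64 * C ^+ 3 * r * (nder (phi R) (mdeg a') * wt l a').
    move=> /rhs_dir tk.
    apply: le_trans (@sconv_le _ _ _ (majs l (nconv f f)) _
      (fun b => r * majs l (nder f) b) _ _ _) _.
    - move=> b _; rewrite -sconv_majs; apply: sconv_le => b' _; exact: hu.
    - move=> b _; have := dser_majs (cdir t) l f b; rewrite {2}/l (negPf tk) => <-.
      by rewrite /dser normrM ger0_norm// ler_wpM2l// hu.
    have -> : sconv (majs l (nconv f f)) (fun b => r * majs l (nder f) b) a' =
        r * majs l (nconv (nconv f f) (nder f)) a'.
      rewrite -sconv_majs /sconv mulr_sumr; apply: eq_bigr => b _; exact: mulrCA.
    have -> : nconv (nconv f f) (nder f) = (fun n => C ^+ 3 *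
        nconv (nconv (phi R) (phi R)) (nder (phi R)) n).
      apply/funext => n; rewrite /nconv mulr_sumr; apply: eq_bigr => j _.
      rewrite [X in X * _](_ : _ = C ^+ 2 *
        \sum_(j0 < j.+1) phi R j0 * phi R (j - j0)); last first.
        by rewrite mulr_sumr; apply: eq_bigr => j' _; rewrite /f; ring.
      by rewrite /nder /f; ring.
    rewrite /majs.
    have := ler_wpM2r (wl a') (nconv_phi3 R (mdeg a')).
    have : 0 <= r * C ^+ 3 by rewrite mulr_ge0// exprn_ge0.
    move=> /ler_wpM2l h1 /h1; congr (_ <= _); ring.
  have : `|cubic_ser (rhs i) (fun i a => u (i, a)) a'| <=
      A * (64 * C ^+ 3 * r * (nder (phi R) (mdeg a') * wt l a')).
    apply: le_trans (ler_norm_sum _ _ _) _.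
    apply: le_trans _ (ler_wpM2r _ (iA i)); last first.
      by apply: mulr_ge0; apply: mulr_ge0; rewrite ?nder_ge0 ?wl// mulr_ge0// exprn_ge0.
    rewrite mulr_suml; move: term; elim: (rhs i) => [|t s IHs] term.
      by rewrite !big_nil.
    rewrite !big_cons lerD//; last by apply: IHs => t' ht'; apply: term; right.
    by rewrite normrM ler_wpM2l//; apply: term; left.
  rewrite normrM normfV normr_nat ler_pdivrMr ?ltr0n// => /le_trans; apply.
  have := wtS l a' k; rewrite aE /l eqxx -/l.
  have -> : ((a' k).+1 = a k)%N by rewrite /a' !ffunE eqxx; lia.
  rewrite /majs aN /f /nder => wE.
  have -> : C * phi R (mdeg a').+1 * wt l a * (a k)%:R =
    C * phi R (mdeg a').+1 * ((a k)%:R * wt l a) by ring.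
  rewrite wE.
  have W : 0 <= (mdeg a').+1%:R * phi R (mdeg a').+1 * wt l a' * r * C.
    by rewrite mulr_ge0// mulr_ge0// mulr_ge0// mulr_ge0// phi_ge0.
  have : 64 * A * C ^+ 2 <= la by rewrite lerDr.
  move=> /(ler_wpM2l W); congr (_ <= _); ring.
exists ((2 ^ d)%:R * (la * r)); split; first by rewrite !mulr_ge0// (le_trans _ la1).
move=> i a; apply: le_trans (bnd (i, a)) _; rewrite /majs /f -mulrA ler_wpM2l//.
by apply: le_trans (ler_piMl _ (phi_le1 _ _)) _ => //; exact: wt_le.
Qed.

Lemma pser_plane (c c' : mi -> R) (z : V) :
  (forall a, a k = 0%N -> c a = c' a) -> z ord0 k = 0 -> pser c z = pser c' z.
Proof.
move=> cc zk; apply: eq_tsum => a; have [/cc-> //|ak] := eqVneq (a k) 0%N.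
by rewrite /monomial (bigD1 k)//= zk expr0n (negPf ak) mul0r !mulr0.
Qed.

(** Two functions equal on the plane have the same coefficients on it: extend the
    difference of their restrictions as a function constant in the variable
    [k], whose series vanishes. *)
Lemma series_plane (g g' : V -> R) (c c' : mi -> R) p :
  has_series g p c -> has_series g' p c' ->
  (\forall x \near p, (x : V) ord0 k = p ord0 k -> g x = g' x) ->
  forall a, a k = 0%N -> c a = c' a.
Proof.
move=> hg hg' gg; have [rho r0 [er eE]] := has_seriesB hg hg'.
pose pl (x : V) : V := \row_j (if j == k then p ord0 k else x ord0 j).
have plk x : pl x ord0 k = p ord0 k by rewrite mxE eqxx.
have plb r x : in_box p r x -> in_box p r (pl x).
  move=> xr i; rewrite mxE; case: eqP => [->|_]; last exact: xr.
  by rewrite subrr normr0 (le_lt_trans _ (xr k)).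
pose e a := if a k == 0%N then c a - c' a else 0.
have ee : abs_at e rho.
  apply: le_lt_trans er; apply: le_asum => a; rewrite /e; case: ifP => // _.
  by rewrite mul0r normr0.
have he : has_series (fun=> 0) p e.
  move/nearP: gg => [r r0' h].
  apply: (@has_series_near _ _ (fun x => pser e (x - p))); last by exists rho.
  apply/nearP; exists (Num.min r rho); first by rewrite lt_min r0'.
  move=> x xm.
  have xr : in_box p r x by apply: in_boxW xm; rewrite ge_min lexx.
  have xrho : in_box p rho x by apply: in_boxW xm; rewrite ge_min lexx orbT.
  transitivity (pser e (pl x - p)).
    apply: eq_tsum => a; rewrite /e; case: eqP => ak; last by rewrite !mul0r.
    congr (_ * _); apply: eq_bigr => i _; rewrite !mxE; case: (eqVneq i k) => [->|//].
    by rewrite ak !expr0.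
  transitivity (pser (fun a => c a - c' a) (pl x - p)).
    apply: pser_plane => [a ak|]; first by rewrite /e ak eqxx.
    by rewrite !mxE eqxx subrr.
  by rewrite -eE ?h ?subrr//; exact: plb.
move=> a ak; have := has_series0 he a.
by rewrite /e ak eqxx => /eqP; rewrite subr_eq0 => /eqP.
Qed.

(** The initial condition is given by functions on the whole space, of which only
    the values on the plane matter. *)
Theorem ck_exists (h : I -> V -> R) p : (forall i, analytic_at (h i) p) ->
  exists U : I -> V -> R, [/\ forall i, analytic_at (U i) p,
    forall i, \forall x \near p,
      'D_(delta_mx ord0 k) (U i) x = cubic_eval (rhs i) U x &
    forall i, \forall x \near p, (x : V) ord0 k = p ord0 k -> U i x = h i x].
Proof.
move=> ha; have /choice[c hc] : forall i, exists c, has_series (h i) p c.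
  by move=> i; apply/analytic_atP.
have /choice[Cq hCq] : forall i, exists Cq : R * R, [/\ 0 <= Cq.1, 0 <= Cq.2 &
    forall a, `|c i a| <= Cq.1 * Cq.2 ^+ mdeg a].
  move=> i; have [rho r0 [/(abs_at_bound r0)[C C0 cC] _]] := hc i.
  by exists (C, rho^-1); split; rewrite //= invr_ge0 ltW.
pose C := \sum_i (Cq i).1; pose q := \sum_i (Cq i).2.
have C0 : 0 <= C by apply: sumr_ge0 => i _; have [] := hCq i.
have q0 : 0 <= q by apply: sumr_ge0 => i _; have [] := hCq i.
have cb i a : `|c i a| <= C * q ^+ mdeg a.
  have [C1 q1 /(_ a)] := hCq i; move=> /le_trans; apply.
  apply: ler_pM => //; first exact: exprn_ge0.
    by rewrite /C (bigD1 i)//= lerDl sumr_ge0// => j _; have [] := hCq j.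
  apply: lerXn2r; rewrite ?nnegrE//.
  by rewrite /q (bigD1 i)//= lerDl sumr_ge0// => j _; have [] := hCq j.
have [q' [q'0 sb]] := ck_sol_bound C0 q0 cb.
have hU i : has_series (fun x => pser (ck_sol c i) (x - p)) p (ck_sol c i).
  have [rho r0 cr] := bound_abs_at q'0 (sb i); exact: has_series_pser r0 cr.
exists (fun i x => pser (ck_sol c i) (x - p)); split=> i.
- by apply/analytic_atP; exists (ck_sol c i).
- have := has_series_deriv k (hU i).
  have -> : dser k (ck_sol c i) = cubic_ser (rhs i) (ck_sol c).
    by apply/funext => a; exact: ck_sol_dser.
  by move=> /has_series_eq; apply; exact: has_series_cubic hU.
- have [rho r0 [_ hE]] := hc i; apply/nearP; exists rho => // x xr xk.
  rewrite hE//; apply: pser_plane => [a|]; first exact: ck_sol_init.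
  by rewrite !mxE xk subrr.
Qed.

Theorem ck_unique (U W : I -> V -> R) p :
  (forall i, analytic_at (U i) p) -> (forall i, analytic_at (W i) p) ->
  (forall i, \forall x \near p,
      'D_(delta_mx ord0 k) (U i) x = cubic_eval (rhs i) U x) ->
  (forall i, \forall x \near p,
      'D_(delta_mx ord0 k) (W i) x = cubic_eval (rhs i) W x) ->
  (forall i, \forall x \near p, (x : V) ord0 k = p ord0 k -> U i x = W i x) ->
  forall i, \forall x \near p, U i x = W i x.
Proof.
move=> Ua Wa Ueq Weq UW i.
have /choice[c hc] : forall i, exists c, has_series (U i) p c.
  by move=> j; apply/analytic_atP.
have /choice[e he] : forall i, exists c, has_series (W i) p c.
  by move=> j; apply/analytic_atP.
have dc j a : dser k (c j) a = cubic_ser (rhs j) c a.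
  apply: (has_series_uniq (has_series_near (Ueq j) (has_series_deriv k (hc j)))).
  exact: has_series_cubic hc.
have de j a : dser k (e j) a = cubic_ser (rhs j) e a.
  apply: (has_series_uniq (has_series_near (Weq j) (has_series_deriv k (he j)))).
  exact: has_series_cubic he.
have c0 j a : a k = 0%N -> e j a = c j a.
  by move=> ak; rewrite (series_plane (hc j) (he j) (UW j) ak).
have ce : forall x : I * mi, c x.1 x.2 = e x.1 x.2.
  apply: (trifix_uniq (@ck_local c)) => x; first exact: step_cubic_ser.
  exact: step_cubic_ser.
apply: has_series_eq (hc i) _; have := he i; congr has_series.
by apply/funext => a; rewrite -(ce (i, a)).
Qed.
End CauchyKovalevskaya.

(** * Closure properties of analytic functions *)

Section AnalyticFunctions.
Variables (R : realType) (d : nat).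
Local Notation V := 'rV[R]_d.
Implicit Types (p : V) (g : V -> R).

Lemma analytic_cst p (k : R) : analytic_at (fun=> k) p.
Proof. by apply/analytic_atP; eexists; exact: has_series_cst. Qed.

Lemma analyticB g g' p : analytic_at g p -> analytic_at g' p ->
  analytic_at (fun x => g x - g' x) p.
Proof.
move=> /analytic_atP[c hc] /analytic_atP[c' hc'].
by apply/analytic_atP; eexists; exact: has_seriesB hc hc'.
Qed.

Lemma analyticM g g' p : analytic_at g p -> analytic_at g' p ->
  analytic_at (fun x => g x * g' x) p.
Proof.
move=> /analytic_atP[c hc] /analytic_atP[c' hc'].
by apply/analytic_atP; eexists; exact: has_seriesM hc hc'.
Qed.

Lemma analyticV g p : analytic_at g p -> g p != 0 ->
  analytic_at (fun x => (g x)^-1) p.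
Proof.
move=> /analytic_atP[c hc] g0; apply/analytic_atP.
by have [_] := has_seriesV hc g0.
Qed.

Lemma analytic_neq0 g p : analytic_at g p -> g p != 0 ->
  \forall x \near p, g x != 0.
Proof. by move=> /analytic_atP[c hc] g0; have [] := has_seriesV hc g0. Qed.

Lemma analytic_deriv g p i : analytic_at g p ->
  analytic_at (fun x => 'D_(delta_mx ord0 i) g x) p.
Proof.
by move=> /analytic_atP[c hc]; apply/analytic_atP; eexists; exact: has_series_deriv hc.
Qed.

Lemma analytic_derivable g p i : analytic_at g p -> derivable g p (delta_mx ord0 i).
Proof. by move=> /analytic_atP[c hc]; have [] := has_series_is_derive i hc. Qed.

Lemma analytic_near g p : analytic_at g p -> \forall x \near p, analytic_at g x.
Proof.
move=> /analytic_atP[c [r r0 [cr gE]]]; apply/nearP.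
exists (r / 2); first by lra.
move=> x xr; apply/analytic_atP; exists (pshift c (x - p)).
exact: pser_has_series xr.
Qed.

(** Uniqueness for the system with a single unknown and no right-hand side. *)
Lemma analytic_eq1_plane g p k : analytic_at g p ->
  (\forall x \near p, 'D_(delta_mx ord0 k) g x = 0) ->
  (\forall x \near p, (x : V) ord0 k = p ord0 k -> g x = 1) ->
  \forall x \near p, g x = 1.
Proof.
move=> ga dg g1.
have ce U x : cubic_eval (nil : seq (cubic R d unit)) U x = 0 :> R.
  by rewrite /cubic_eval big_nil.
apply: (@ck_unique R d unit (fun=> [::]) k _ (fun=> g) (fun=> fun=> 1) p _ _ _ _ _ tt) => //.
- by move=> _; exact: analytic_cst.
- move=> _; move/nearP: dg => [r r0 h]; apply/nearP; exists r => // x xr.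
  by rewrite ce h.
- by move=> _; apply/nearP; exists 1 => // x _; rewrite ce derive_cst.
Qed.
Lemma near_forall (I : finType) p (P : I -> V -> Prop) :
  (forall i, \forall x \near p, P i x) -> \forall x \near p, forall i, P i x.
Proof. by move=> h; apply: (@filter_forall V I P (nbhs p) _ h). Qed.
End AnalyticFunctions.

(** * Restriction to and extension from coordinate planes *)

Section CoordinatePlanes.
Variables (R : realType) (m d : nat) (sg : 'I_m -> 'I_d).
Hypothesis sg_inj : injective sg.
Implicit Types (a : {ffun 'I_d -> nat}) (b : {ffun 'I_m -> nat}).

(** The coordinate plane on which the variables outside the image of [sg] vanish:
    its parametrization, and the coordinates on it. *)
Definition plane_emb (y : 'rV[R]_m) : 'rV[R]_d :=
  \row_i \sum_(j | sg j == i) y ord0 j.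
Definition plane_proj (x : 'rV[R]_d) : 'rV[R]_m := \row_j x ord0 (sg j).
(** The exponents of the monomials in the variables of the plane only, and the
    restriction of an exponent to these variables. *)
Definition mext b : {ffun 'I_d -> nat} := [ffun i => \sum_(j | sg j == i) b j]%N.
Definition mres a : {ffun 'I_m -> nat} := [ffun j => a (sg j)].

Lemma plane_embE y j : plane_emb y ord0 (sg j) = y ord0 j.
Proof.
by rewrite mxE (big_pred1 j)// => j'; rewrite /= (inj_eq sg_inj).
Qed.

Lemma plane_emb0 y i : (forall j, sg j != i) -> plane_emb y ord0 i = 0.
Proof. by move=> h; rewrite mxE big_pred0// => j; rewrite (negPf (h j)). Qed.

Lemma plane_embK y : plane_proj (plane_emb y) = y.
Proof. by apply/rowP => j; rewrite mxE plane_embE. Qed.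

Lemma mextE b j : mext b (sg j) = b j.
Proof.
by rewrite ffunE (big_pred1 j)// => j'; rewrite /= (inj_eq sg_inj).
Qed.

Lemma mextK b : mres (mext b) = b.
Proof. by apply/ffunP => j; rewrite ffunE mextE. Qed.

Lemma mext_inj : injective mext.
Proof. by move=> b b' h; rewrite -(mextK b) h mextK. Qed.

Lemma not_mext a : (forall b, mext b <> a) -> exists2 i, (forall j, sg j != i) & a i != 0%N.
Proof.
move=> h; have /ffunP/existsNP[i ai] : mext (mres a) <> a by exact: h.
have ni j : sg j != i by apply/eqP => ji; apply: ai; rewrite -ji mextE ffunE.
exists i => //; apply/eqP => a0; apply: ai; rewrite a0 ffunE big_pred0// => j.
exact/negbTE.
Qed.

Lemma monomial_mext b (z : 'rV[R]_d) : monomial (mext b) z = monomial b (plane_proj z).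
Proof.
rewrite /monomial [RHS](partition_big sg predT)//=; apply: eq_bigr => i _.
rewrite ffunE expr_sum; apply: eq_bigr => j /eqP <-; by rewrite mxE.
Qed.

Lemma mdeg_mext b : mdeg (mext b) = mdeg b.
Proof.
rewrite /mdeg [RHS](partition_big sg predT)//=; apply: eq_bigr => i _.
by rewrite ffunE.
Qed.

Lemma near_plane (p : 'rV[R]_d) (P : 'rV[R]_d -> Prop) : (\forall x \near p, P x) ->
  \forall y \near (0 : 'rV[R]_m), P (p + plane_emb y).
Proof.
move=> /nearP[r r0 h]; apply/nearP; exists r => // y yr; apply: h => i.
rewrite mxE addrAC subrr add0r; have [[j <-]|ni] := pselect (exists j, sg j = i).
  by rewrite plane_embE; have := yr j; rewrite mxE subr0.
by rewrite plane_emb0 ?normr0// => j; apply/eqP => ji; apply: ni; exists j.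
Qed.

Lemma analytic_plane g (p : 'rV[R]_d) : analytic_at g p ->
  analytic_at (fun y : 'rV[R]_m => g (p + plane_emb y)) 0.
Proof.
move=> /analytic_atP[c [rho r0 [cr gE]]]; apply/analytic_atP; exists (c \o mext).
have vanish (z : 'rV[R]_d) a : (forall j, z ord0 j != 0 -> exists i, sg i = j) ->
    (forall b, mext b <> a) -> c a * monomial a z = 0.
  move=> hz /not_mext[i ni ai]; rewrite /monomial (bigD1 i)//=.
  have [->|/hz[j ji]] := eqVneq (z ord0 i) 0; last by have := ni j; rewrite ji eqxx.
  by rewrite expr0n (negPf ai) mul0r mulr0.
have [M M0 ME] := asum_fineP cr.
exists rho => //; split.
  apply: (@le_lt_trans _ _ M%:E); last by rewrite ltry.
  apply: asum_le => s us.
  have um : uniq (map mext s) by rewrite (map_inj_uniq mext_inj).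
  rewrite -lee_fin; apply: le_trans _ (le_trans (asum_ge _ um)
    (eq_ind _ (fun t => (t <= M%:E)%E) (lexx _) _ (esym ME))).
  rewrite big_map lee_fin; apply: ler_sum => b _; by rewrite mdeg_mext.
move=> y yr; rewrite subr0 gE; last first.
  move=> i; rewrite mxE addrAC subrr add0r.
  have [[j <-]|ni] := pselect (exists j, sg j = i).
    by rewrite plane_embE; have := yr j; rewrite mxE subr0.
  by rewrite plane_emb0 ?normr0// => j; apply/eqP => ji; apply: ni; exists j.
rewrite addrAC subrr add0r /pser (tsum_inj mext_inj) => [|a ha]; last first.
  apply: vanish => // i; apply: contra_neqP => hi; apply: plane_emb0 => j.
  by apply/eqP => ji; apply: hi; exists j.
by apply: eq_tsum => b; rewrite /= monomial_mext plane_embK.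
Qed.

(** An analytic function on the plane, extended by a function independent of the
    other variables. *)
Lemma analytic_proj g (p : 'rV[R]_d) : analytic_at g (0 : 'rV[R]_m) ->
  analytic_at (fun x : 'rV[R]_d => g (plane_proj (x - p))) p.
Proof.
move=> /analytic_atP[c [rho r0 [cr gE]]]; apply/analytic_atP.
pose e a := if `[< exists b, mext b = a >] then c (mres a) else 0.
have ez a (t : R) : (forall b, mext b <> a) -> e a * t = 0.
  move=> h; rewrite /e; case: asboolP => [[b ba]|_]; last by rewrite mul0r.
  by have := h b.
have eE b : e (mext b) = c b.
  by rewrite /e mextK; case: asboolP => // -[]; exists b.
exists e; exists rho => //; split.
  rewrite /abs_at (asum_inj mext_inj) => [|a]; last exact: ez.
  by move: cr; congr (_ < _)%E; apply: eq_asum => b; rewrite /= eE mdeg_mext.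
move=> x xr; rewrite gE; last by move=> j; rewrite !mxE subr0 xr.
rewrite subr0 /pser [RHS](tsum_inj mext_inj) => [|a]; last exact: ez.
by apply: eq_tsum => b; rewrite /= eE monomial_mext.
Qed.
End CoordinatePlanes.

(** * The Beltrami equations as a Cauchy-Kovalevskaya system *)

Section BeltramiSystem.
Variables (R : realType) (k : 'I_3).
Local Notation V := 'rV[R]_3.
Implicit Types (p : V) (u : 'I_3 -> V -> R) (w e : V -> R).

(** The unknowns of the system: the components [u i] of the field, the reciprocal
    [w] of [u k], the constant 1 (which lets terms of degree less than three be
    written as cubic ones), and the defect [w * u k - 1], which vanishes on the
    solutions of interest. *)
Definition unknown : finType := ('I_3 + 'I_3)%type.
Definition ucomp (i : 'I_3) : unknown := inl i.
Definition urecip : unknown := inr 0.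
Definition uone : unknown := inr 1.
Definition udefect : unknown := inr 2.

(** The right-hand sides of the system, [k] being the evolution direction.  In
    [inr j], the values 0, 1 and 2 of [j] stand for the reciprocal, the constant
    and the defect. *)
Definition beltrami_rhs (X : unknown) : seq (cubic R 3 unknown) :=
  match X with
  | inl i =>
    if i == k + 1 then
      [:: Cubic 1 uone uone (ucomp k) (k + 1);
          Cubic 1 (ucomp (k + 2)) urecip (ucomp (k + 2)) (k + 1);
          Cubic (-1) (ucomp (k + 2)) urecip (ucomp (k + 1)) (k + 2)]
    else if i == k + 2 then
      [:: Cubic 1 uone uone (ucomp k) (k + 2);
          Cubic (-1) (ucomp (k + 1)) urecip (ucomp (k + 2)) (k + 1);
          Cubic 1 (ucomp (k + 1)) urecip (ucomp (k + 1)) (k + 2)]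
    else
      [:: Cubic (-1) uone uone (ucomp (k + 1)) (k + 1);
          Cubic (-1) uone uone (ucomp (k + 2)) (k + 2)]
  | inr j =>
    if j == 0 then
      [:: Cubic 1 urecip urecip (ucomp (k + 1)) (k + 1);
          Cubic 1 urecip urecip (ucomp (k + 2)) (k + 2)]
    else if j == 1 then [::]
    else
      [:: Cubic 1 urecip udefect (ucomp (k + 1)) (k + 1);
          Cubic 1 urecip udefect (ucomp (k + 2)) (k + 2)]
  end.

Lemma ord3D1 (j : 'I_3) : (j + 1 == j) = false.
Proof. by case: j => [[|[|[|]]]]. Qed.

Lemma ord3D2 (j : 'I_3) : (j + 2 == j) = false.
Proof. by case: j => [[|[|[|]]]]. Qed.

Lemma ord3D21 (j : 'I_3) : (j + 2 == j + 1) = false.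
Proof. by case: j => [[|[|[|]]]]. Qed.

Lemma ord3D11 (j : 'I_3) : j + 1 + 1 = j + 2.
Proof. by rewrite -addrA. Qed.

Lemma ord3D12 (j : 'I_3) : j + 1 + 2 = j.
Proof. by case: j => [[|[|[|]]]] //= ?; apply/val_inj. Qed.

Lemma ord3D21' (j : 'I_3) : j + 2 + 1 = j.
Proof. by case: j => [[|[|[|]]]] //= ?; apply/val_inj. Qed.

Lemma ord3D22 (j : 'I_3) : j + 2 + 2 = j + 1.
Proof. by case: j => [[|[|[|]]]] //= ?; apply/val_inj. Qed.

Lemma ord3_cases (j i : 'I_3) : [\/ i = j, i = j + 1 | i = j + 2].
Proof.
have : [|| i == j, i == j + 1 | i == j + 2].
  by case: j => [[|[|[|]]]] // ?; case: i => [[|[|[|]]]].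
by case/or3P => /eqP ->; [constructor 1|constructor 2|constructor 3].
Qed.

Lemma sum_ord3 (F : 'I_3 -> R) (j : 'I_3) : \sum_i F i = F j + F (j + 1) + F (j + 2).
Proof.
rewrite (reindex_inj (addrI j)) !big_ord_recl big_ord0 /= !addr0 -[RHS]addrA.
by congr (_ + (F _ + F _)); congr (_ + _); apply/val_inj.
Qed.

Lemma beltrami_rhs_dir X t : List.In t (beltrami_rhs X) -> cdir t != k.
Proof.
by case: X => j /=; case: ifP => _ /=; [|case: ifP => _ /= |  |case: ifP => _ /=];
  intuition subst => //=; rewrite ?ord3D1 ?ord3D2.
Qed.

Local Notation D i g := ('D_(delta_mx ord0 i) g).

(** The functions [u], [w], [o] and [e] as a family indexed by the unknowns. *)
Definition family u w (o e : V -> R) (X : unknown) : V -> R :=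
  match X with
  | inl i => u i
  | inr j => if j == 0 then w else if j == 1 then o else e
  end.

(** The Beltrami equations at [x] where [w] is the reciprocal of [u k]: the [k]-th
    component of the curl gives the factor [f], the other two and the divergence
    give the derivatives of [u] in the direction [k]. *)
Definition beltrami_evol u w (x : V) :=
  let f := (D (k + 1) (u (k + 2)) x - D (k + 2) (u (k + 1)) x) * w x in
  let div := D (k + 1) (u (k + 1)) x + D (k + 2) (u (k + 2)) x in
  [/\ D k (u (k + 1)) x = D (k + 1) (u k) x + f * u (k + 2) x,
      D k (u (k + 2)) x = D (k + 2) (u k) x - f * u (k + 1) x,
      D k (u k) x = - div &
      D k w x = w x * w x * div].

Lemma family_system u w e x : beltrami_evol u w x ->
  D k e x = w x * e x *
    (D (k + 1) (u (k + 1)) x + D (k + 2) (u (k + 2)) x) ->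
  forall X, D k (family u w (fun=> 1) e X) x =
    cubic_eval (beltrami_rhs X) (family u w (fun=> 1) e) x.
Proof.
move=> [h1 h2 h3 h4] h5 [i|j] /=; rewrite /cubic_eval.
  have [->|->|->] := ord3_cases k i.
  - by rewrite ![k == _]eq_sym ord3D1 ord3D2 !big_cons big_nil /= h3; ring.
  - by rewrite eqxx !big_cons big_nil /= h1; ring.
  - by rewrite ord3D21 eqxx !big_cons big_nil /= h2; ring.
case: ifP => _; first by rewrite !big_cons big_nil /= h4; ring.
case: ifP => _; first by rewrite big_nil derive_cst.
by rewrite !big_cons big_nil /= h5; ring.
Qed.

Lemma system_evol (F : unknown -> V -> R) x : F uone x = 1 ->
  (forall X, D k (F X) x = cubic_eval (beltrami_rhs X) F x) ->
  beltrami_evol (fun i => F (ucomp i)) (F urecip) x.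
Proof.
move=> o1 h; split; rewrite h /cubic_eval /=.
- by rewrite eqxx !big_cons big_nil /= o1; ring.
- by rewrite ord3D21 eqxx !big_cons big_nil /= o1; ring.
- by rewrite ![k == _]eq_sym ord3D1 ord3D2 !big_cons big_nil /= o1; ring.
- by rewrite !big_cons big_nil /=; ring.
Qed.

(** A Beltrami field satisfies the evolution system where its [k]-th component
    does not vanish. *)
Lemma beltrami_near (U : set V) p (v : V -> V) :
  solution_near (@beltrami_field R) U p v -> v p ord0 k != 0 ->
  let u i x := v x ord0 i in let w x := (v x ord0 k)^-1 in
  (forall i, analytic_at (u i) p) /\ \forall x \near p, beltrami_evol u w x.
Proof.
move=> [B [Bo Bp _ [va [f [fa veq]]]]] vk u w; split; first by move=> i; exact: va.
have nB : \forall x \near p, B x by exact: open_nbhs_nbhs.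
have n0 : \forall x \near p, v x ord0 k != 0 by apply: analytic_neq0 vk; exact: va.
apply: filterS2 nB n0 => x Bx xk.
have [hc hd] := veq x Bx.
have dk : derivable (u k) x (delta_mx ord0 k) by apply: analytic_derivable; exact: va.
have c0 := congr1 (fun z : V => z ord0 k) hc.
have c1 := congr1 (fun z : V => z ord0 (k + 1)) hc.
have c2 := congr1 (fun z : V => z ord0 (k + 2)) hc.
move: c0 c1 c2 hd; rewrite !mxE ord3D11 ord3D12 ord3D21' ord3D22.
rewrite /divergence (sum_ord3 _ k) /partial -/(u _) => c0 c1 c2 hd.
have fE : (D (k + 1) (u (k + 2)) x - D (k + 2) (u (k + 1)) x) * w x = f x.
  by rewrite c0 /w mulfK.
have h3 : D k (u k) x = - (D (k + 1) (u (k + 1)) x + D (k + 2) (u (k + 2)) x).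
  by apply/eqP; rewrite -addr_eq0 addrA hd.
split; rewrite ?fE.
- by rewrite -c2; ring.
- by rewrite -c1; ring.
- exact: h3.
- by rewrite /w deriveV// h3 /GRing.scale /=; field.
Qed.

(** A Beltrami field transverse to the plane is determined by its values on it. *)
Lemma beltrami_unique (U : set V) p (v v' : V -> V) :
  solution_near (@beltrami_field R) U p v -> v p ord0 k != 0 ->
  solution_near (@beltrami_field R) U p v' -> v' p ord0 k != 0 ->
  (\forall x \near p, (x : V) ord0 k = p ord0 k -> v x = v' x) ->
  \forall x \near p, v x = v' x.
Proof.
move=> hv vk hv' vk' vv.
have sys (y : V -> V) : solution_near (@beltrami_field R) U p y -> y p ord0 k != 0 ->
  let F := family (fun i x => y x ord0 i) (fun x => (y x ord0 k)^-1) (fun=> 1) (fun=> 0) in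
  (forall X, analytic_at (F X) p) /\ (forall X, \forall x \near p,
    D k (F X) x = cubic_eval (beltrami_rhs X) F x).
  move=> hy yk; have [ya yev] := beltrami_near hy yk; split.
    move=> [i|j] /=; first exact: ya.
    case: ifP => _; first by apply: analyticV yk; exact: ya.
    by case: ifP => _; exact: analytic_cst.
  move=> X; apply: filterS yev => x hx; apply: (family_system (e := fun=> 0) hx).
  by rewrite derive_cst; ring.
have [a1 e1] := sys _ hv vk; have [a2 e2] := sys _ hv' vk'.
have plane : forall X : unknown, \forall x \near p, (x : V) ord0 k = p ord0 k ->
    family (fun i x => v x ord0 i) (fun x => (v x ord0 k)^-1) (fun=> 1) (fun=> 0) X x =
    family (fun i x => v' x ord0 i) (fun x => (v' x ord0 k)^-1) (fun=> 1) (fun=> 0) X x.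
  move=> X; apply: filterS vv => x h /h vx; case: X => [i|j] /=; first by rewrite vx.
  by case: ifP => _; rewrite ?vx.
have := near_forall (ck_unique beltrami_rhs_dir a1 a2 e1 e2 plane).
apply: filterS => x h; apply/rowP => i; exact: (h (ucomp i)).
Qed.

(** Any analytic field transverse to the plane along it is equal there to a
    Beltrami field. *)
Lemma beltrami_exists (U : set V) p (h : 'I_3 -> V -> R) : open U -> U p ->
  (forall i, analytic_at (h i) p) -> h k p != 0 ->
  exists v : V -> V, solution_near (@beltrami_field R) U p v /\
    forall i, \forall x \near p, (x : V) ord0 k = p ord0 k -> v x ord0 i = h i x.
Proof.
move=> Uo Up ha hk.
have Fa : forall X, analytic_at (family h (fun x => (h k x)^-1) (fun=> 1) (fun=> 0) X) p.
  move=> [i|j] /=; first exact: ha.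
  case: ifP => _; first exact: analyticV.
  by case: ifP => _; exact: analytic_cst.
have [F [Fan Feq Fin]] := ck_exists beltrami_rhs_dir Fa.
pose v x : V := \row_i F (ucomp i) x.
have vE i : (fun x => v x ord0 i) = F (ucomp i) by apply/funext => x; rewrite mxE.
have o1 : \forall x \near p, F uone x = 1.
  apply: (@analytic_eq1_plane _ _ _ _ k) => //.
  by move: (Feq uone); apply: filterS => x; rewrite /cubic_eval big_nil.
have ev : \forall x \near p, beltrami_evol (fun i => F (ucomp i)) (F urecip) x.
  apply: filterS2 o1 (near_forall Feq) => x ox hx; exact: system_evol.
have an : \forall x \near p, forall X, analytic_at (F X) x.
  by apply: near_forall => X; exact: analytic_near.
pose e x := F urecip x * F (ucomp k) x - 1.
(* The defect satisfies a linear equation and vanishes on the plane: the solution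
   with defect [e] and the one with defect 0 coincide. *)
have e0 : \forall x \near p, e x = 0.
  pose G e := family (fun i => F (ucomp i)) (F urecip) (fun=> 1) e.
  have ea : analytic_at e p by apply: analyticB (analytic_cst _ _); exact: analyticM.
  have Ga (y : V -> R) : analytic_at y p -> forall X, analytic_at (G y X) p.
    move=> ya [i|j] /=; first exact: Fan.
    case: ifP => _; first exact: Fan.
    by case: ifP => _ //; exact: analytic_cst.
  apply: (ck_unique beltrami_rhs_dir (Ga _ ea) (Ga _ (analytic_cst p 0)) _ _ _ udefect).
  - move=> X; apply: filterS2 ev an => x hx ax; apply: family_system => //.
    have [_ _ h3 h4] := hx.
    have dW : derivable (F urecip) x (delta_mx ord0 k) by exact: analytic_derivable.
    have dU : derivable (F (ucomp k)) x (delta_mx ord0 k) by exact: analytic_derivable.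
    have -> : e = F urecip * F (ucomp k) - cst 1 by apply/funext.
    rewrite deriveB//; last exact: derivableM.
    rewrite derive_cst deriveM// h3 h4 /GRing.scale /=.
    rewrite -[(F urecip * F (ucomp k) - cst 1) x]/(F urecip x * F (ucomp k) x - 1); ring.
  - move=> X; apply: filterS ev => x hx; apply: family_system => //.
    by rewrite derive_cst; ring.
  - move=> [i|j] /=; first by apply/nearP; exists 1.
    case: ifP => _; first by apply/nearP; exists 1.
    case: ifP => _; first by apply/nearP; exists 1.
    have hk0 := analytic_neq0 (ha k) hk.
    apply: filterS3 (Fin urecip) (Fin (ucomp k)) hk0 => x hw hu hkx xk.
    by rewrite /e hw// hu//= mulVf// subrr.
pose f x := (D (k + 1) (F (ucomp (k + 2))) x - D (k + 2) (F (ucomp (k + 1))) x) * F urecip x.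
have fa : \forall x \near p, analytic_at f x.
  by apply: analytic_near; apply: analyticM => //; apply: analyticB; exact: analytic_deriv.
pose P x := [/\ U x, forall X, analytic_at (F X) x, analytic_at f x,
  beltrami_evol (fun i => F (ucomp i)) (F urecip) x & e x = 0].
have Pp : \forall x \near p, P x.
  have nU : \forall x \near p, U x by exact: open_nbhs_nbhs.
  move/nearP: nU an fa ev e0 => [r1 p1 H1] /nearP[r2 p2 H2] /nearP[r3 p3 H3]
    /nearP[r4 p4 H4] /nearP[r5 p5 H5].
  apply/nearP; exists (Num.min r1 (Num.min r2 (Num.min r3 (Num.min r4 r5)))).
    by rewrite !lt_min p1 p2 p3 p4.
  by move=> x xr; split; [apply: H1|apply: H2|apply: H3|apply: H4|apply: H5];
    apply: in_boxW xr; rewrite !ge_min lexx ?orbT.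
exists v; split; last first.
  move=> i; apply: filterS (Fin (ucomp i)) => x hx /hx; by rewrite mxE.
exists (interior P); split.
- exact: open_interior.
- exact: Pp.
- by move=> x /interior_subset[].
split=> [i x /interior_subset[_ ax _ _ _]|]; first by rewrite vE.
exists f; split=> [x /interior_subset[]//|x /interior_subset[_ ax _ [h1 h2 h3 h4] ex]].
have wu : F urecip x * F (ucomp k) x = 1 by apply/eqP; rewrite -subr_eq0 -/(e x) ex.
split; last first.
  by rewrite /divergence (sum_ord3 _ k) /partial !vE h3; ring.
apply/rowP => i; rewrite !mxE /partial !vE.
have [->|->|->] := ord3_cases k i.
- by rewrite /f -mulrA wu mulr1.
- by rewrite ord3D11 ord3D12 h2 -/(f x); ring.
- by rewrite ord3D21' ord3D22 h1 -/(f x); ring.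
Qed.
End BeltramiSystem.

(** * The Cauchy data *)

Section InitialPlane.
Variables (R : realType) (k : 'I_3).
Local Notation V := 'rV[R]_3.

(** The two directions of the plane, [k + 1] and [k + 2] modulo 3. *)
Definition plane_index (j : 'I_2) : 'I_3 := k + 1 + widen_ord (isT : (2 <= 3)%N) j.

Lemma plane_index_inj : injective plane_index.
Proof. by move=> i j /addrI/(congr1 val) /= ij; apply/val_inj. Qed.

Lemma plane_index_neq j : plane_index j != k.
Proof.
by rewrite /plane_index; case: k => [[|[|[|]]]] //; case: j => [[|[|]]].
Qed.

(** The frame whose rows are the unit vectors of indices [k + 1], [k + 2] and
    [k]. *)
Definition frame : 'M[R]_3 := perm_mx (perm (@addrI _ (k + 1))).

Lemma frame_unit : frame \in unitmx.
Proof. exact: unitmx_perm. Qed.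

Lemma frame_plane (y : 'rV[R]_2) :
  y *m (pid_mx 2 : 'M[R]_(2, 3)) *m frame = plane_emb plane_index y.
Proof.
apply/rowP => i; rewrite -mulmxA !mxE [RHS]big_mkcond; apply: eq_bigr => j _.
rewrite !mxE (bigD1 (widen_ord (isT : (2 <= 3)%N) j))//= big1 => [|l lj].
  rewrite !mxE /= eqxx ltn_ord mul1r addr0 permE -/(plane_index j).
  by case: eqP; rewrite ?mulr1 ?mulr0.
rewrite !mxE; have -> : (j == l :> nat) = false; last by rewrite mul0r.
by apply/negbTE; apply: contra lj => /eqP jl; apply/eqP/val_inj.
Qed.

Lemma plane_coord (p : V) (y : 'rV[R]_2) :
  (p + plane_emb plane_index y) ord0 k = p ord0 k.
Proof. by rewrite mxE plane_emb0 ?addr0// => j; exact: plane_index_neq. Qed.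

Lemma plane_point (p x : V) : x ord0 k = p ord0 k ->
  x = p + plane_emb plane_index (plane_proj plane_index (x - p)).
Proof.
move=> xk; apply/rowP => i; rewrite mxE.
have [->|ik] := eqVneq i k; first by rewrite xk plane_emb0 ?addr0// => j; exact: plane_index_neq.
have [j <-] : exists j, plane_index j = i.
  have [ik0|->|->] := ord3_cases k i; first by rewrite ik0 eqxx in ik.
    by exists ord0; apply/val_inj; rewrite /= addn0 modn_mod.
  by exists ord_max; rewrite /plane_index -addrA; congr (_ + _); apply/val_inj.
by rewrite (plane_embE plane_index_inj) !mxE addrC subrK.
Qed.

(** The [j]-th component of the field on the plane. *)
Definition component (j : 'I_3) : datum R 3 3 := Datum 2 (delta_mx j ord0) [::].

Lemma datum_component p j (u : V -> V) (y : 'rV[R]_2) :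
  datum_value p frame (s := component j) u y = u (p + plane_emb plane_index y) ord0 j.
Proof. by rewrite /datum_value /= frame_plane -colE mxE. Qed.

Lemma open_coord_neq0 : open [set w : V | w ord0 k != 0].
Proof.
rewrite openE => w /= wk.
have r0 : 0 < `|w ord0 k| by rewrite normr_gt0.
apply/nearP; exists `|w ord0 k| => // x /(_ k) xk; apply/eqP => x0.
by move: xk; rewrite x0 sub0r normrN ltxx.
Qed.
End InitialPlane.

Theorem theorem1p1 (R : realType) (U : set 'rV[R]_3) (hU : open U) :
  locally_parametrized (@beltrami_field R) U [set a : 'rV[R]_3 | a != 0] 3 2.
Proof.
split.
- rewrite openE => a /= /rV0Pn[k ak].
  have := @open_coord_neq0 R k; rewrite openE => /(_ a ak).
  by apply: filterS => x /= xk; apply/rV0Pn; exists k.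
- move=> O [x Ox] Oo; have [x0|x0] := eqVneq x 0; last by exists x.
  have /nearP[r r0 h] : \forall y \near x, O y by exact: open_nbhs_nbhs.
  exists (const_mx (r / 2)); split.
    by apply: h => i; rewrite x0 !mxE subr0 gtr0_norm; lra.
  by apply/rV0Pn; exists 0; rewrite mxE gt_eqF//; lra.
move=> p a Up /= /rV0Pn[k ak].
(* Transversality to the plane is the only condition, both on the value of the
   field at [p] and on that of the data at 0. *)
pose W := [set w : 'rV[R]_3 | w ord0 k != 0].
exists W, (frame R k), 3%N, (component R), W; split.
- by split; [exact: open_coord_neq0|].
- exact: frame_unit.
- split; first exact: open_coord_neq0.
  by exists (const_mx 1); rewrite /W /= mxE oner_eq0.
- by split => //; rewrite (eq_card (B := predT)) ?card_ord.
have dat u j : datum_value p (frame R k) (s := component R j) u =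
    (fun y => u (p + plane_emb (plane_index k) y) ord0 j).
  by apply/funext => y; exact: datum_component.
have emb0 : p + plane_emb (plane_index k) 0 = p.
  apply/rowP => i; rewrite !mxE big1 ?addr0// => j _; exact: mxE.
split.
- move=> u hu uk; have [ua _] := beltrami_near hu uk; split=> [j|].
    by rewrite dat; have := analytic_plane (@plane_index_inj k) (ua j).
  by rewrite /W /= mxE dat emb0.
- move=> phi phia phi0.
  pose h j x := phi j (plane_proj (plane_index k) (x - p)).
  have hp j : h j p = phi j 0.
    by rewrite /h subrr; congr phi; apply/rowP => i; rewrite !mxE.
  have ha j : analytic_at (h j) p.
    exact: (@analytic_proj _ _ _ _ (@plane_index_inj k) (phi j) p (phia j)).
  have hk : h k p != 0 by rewrite hp; move: phi0; rewrite /W /= mxE.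
  have [v [vs vh]] := beltrami_exists hU Up ha hk.
  exists v; split=> //.
    rewrite /W /=; have /nearP[r r0 /(_ p)] := vh k.
    by move=> -> //; exact: in_box0.
  move=> j; have := near_plane (@plane_index_inj k) (vh j).
  apply: filterS => y; rewrite plane_coord dat => -> //.
  by rewrite /h addrAC subrr add0r (plane_embK (@plane_index_inj k)).
move=> u v hu uk hv vk uv; apply: (beltrami_unique hu uk hv vk).
have /nearP[r r0 H] : \forall y \near (0 : 'rV[R]_2), forall j,
    u (p + plane_emb (plane_index k) y) ord0 j = v (p + plane_emb (plane_index k) y) ord0 j.
  by apply: near_forall => j; have := uv j; rewrite !dat.
apply/nearP; exists r => // x xr xk; rewrite (plane_point xk); apply/rowP => j.
by apply: H => i; rewrite !mxE subr0; exact: xr.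
Qed.
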